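(* Let $d\ge1$, let $B_1,\dots,B_d$ be standard one-dimensional Brownian motions, independent from each other and from a standard Cauchy process $C(t)$, $t>0$. The joint density of the vector process $J_{BC}^d(t)=\big(B_1(|C(t)|),\dots,B_d(|C(t)|)\big)$, $t>0$, which is given by $$p_{BC}^d(x_1,\dots,x_d,t)=\frac{2}{\pi}\int_0^{+\infty}\prod_{j=1}^d\frac{e^{-\frac{x_j^2}{2s}}}{\sqrt{2\pi s}}\,\frac{t}{t^2+s^2}\,ds,$$ is a solution to the equation $$\frac{\partial^2p}{\partial t^2}=-\frac{1}{2^2}\left(\sum_{j=1}^d\frac{\partial^2}{\partial x_j^2}\right)^2p(x_1,\dots,x_d,t)-\frac{1}{\pi t}\sum_{j=1}^d\delta(x_1)\cdots\frac{d^2}{dx_j^2}\delta(x_j)\cdots\delta(x_d),$$ with initial condition $p(x_1,\dots,x_d,0)=\prod_{j=1}^d\delta(x_j)$.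
   Context: Here $x_j\in\mathbb{R}$ for $j=1,\dots,d$ and $t>0$. $\delta$ is the Dirac delta function and its derivatives are those of generalized functions; in the $j$-th summand the factor $\delta(x_j)$ is replaced by its second derivative and all other factors are $\delta(x_k)$, $k\ne j$. The Cauchy process $C(t)$ has density $\frac{t}{\pi(t^2+x^2)}$. *)

(* Defs.v *)
From HB Require Import structures.
From mathcomp Require Import all_boot all_order all_algebra.
From mathcomp Require Import all_classical all_reals all_analysis.
From mathcomp Require Import measurable_realfun.

Set Implicit Arguments.
Unset Strict Implicit.
Unset Printing Implicit Defensive.

Import Order.TTheory GRing.Theory Num.Theory.
Import numFieldNormedType.Exports.

Local Open Scope classical_set_scope.
Local Open Scope ring_scope.

Lemma sigma_finite_product d1 d2 (T1 : measurableType d1)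
    (T2 : measurableType d2) (R : realType)
    (m1 : {sigma_finite_measure set T1 -> \bar R})
    (m2 : {sigma_finite_measure set T2 -> \bar R}) :
  sigma_finite setT (m1 \x m2)%E.
Proof.
have /sigma_finiteP[F [TF ndF Foo]] := sigma_finiteT m1.
have /sigma_finiteP[G [TG ndG Goo]] := sigma_finiteT m2.
exists (fun n => F n `*` G n).
  rewrite -setXTT TF TG predeqE => -[x y]; split.
    move=> [/= [n _ Fnx] [k _ Gky]]; exists (maxn n k) => //; split.
    - by move: x Fnx; exact/subsetPset/ndF/leq_maxl.
    - by move: y Gky; exact/subsetPset/ndG/leq_maxr.
  by move=> [n _ []/= ? ?]; split; exists n.
move=> k; have [? ?] := Foo k; have [? ?] := Goo k.
split; first exact: measurableX.
by rewrite product_measure1E// lte_mul_pinfty// ge0_fin_numE.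
Qed.

Section lebesgue_tuple_step.
Context {R : realType} (n : nat).
Local Open Scope ereal_scope.
Variable m : {sigma_finite_measure set (n.-tuple R) -> \bar R}.

Definition tuple_cons (p : measurableTypeR R * n.-tuple R) : n.+1.-tuple R :=
  [tuple of p.1 :: p.2].

Definition tuple_uncons (x : n.+1.-tuple R) :
    measurableTypeR R * n.-tuple R :=
  (thead x, [tuple of behead x]).

Lemma tuple_consK : cancel tuple_cons tuple_uncons.
Proof.
move=> [a x]; rewrite /tuple_uncons /tuple_cons /=; congr pair.
exact: val_inj.
Qed.

Lemma tuple_unconsK : cancel tuple_uncons tuple_cons.
Proof. by move=> x; rewrite /tuple_cons /= [RHS]tuple_eta. Qed.

Lemma measurable_tuple_cons : measurable_fun setT tuple_cons.
Proof. by apply: measurable_cons => //; exact: measurable_fst. Qed.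

Lemma measurable_tuple_uncons :
  measurable_fun setT tuple_uncons.
Proof.
apply: measurable_fun_pair => /=; last exact: measurable_behead.
exact: measurable_tnth.
Qed.

Definition lebesgue_step : set (n.+1.-tuple R) -> \bar R :=
  pushforward (lebesgue_measure \x m) tuple_cons.

Let lebesgue_step0 : lebesgue_step set0 = 0.
Proof. by rewrite /lebesgue_step /pushforward preimage_set0 measure0. Qed.

Let lebesgue_step_ge0 A : 0 <= lebesgue_step A.
Proof. by rewrite /lebesgue_step /pushforward measure_ge0. Qed.

Let lebesgue_step_sigma_additive : semi_sigma_additive lebesgue_step.
Proof.
move=> F mF tF mUF; rewrite /lebesgue_step /pushforward preimage_bigcup.
apply: measure_semi_sigma_additive.
- by move=> k; rewrite -[X in measurable X]setTI; exact: measurable_tuple_cons.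
- apply/trivIsetP => /= i j _ _ ij; rewrite -preimage_setI.
  by move/trivIsetP : tF => /(_ _ _ _ _ ij) ->//; rewrite preimage_set0.
- rewrite -preimage_bigcup -[X in measurable X]setTI.
  exact: measurable_tuple_cons.
Qed.

HB.instance Definition _ := isMeasure.Build _ _ _ lebesgue_step
  lebesgue_step0 lebesgue_step_ge0 lebesgue_step_sigma_additive.

Let lebesgue_step_sigma_finite : sigma_finite setT lebesgue_step.
Proof.
have [F UF mF] : sigma_finite setT (lebesgue_measure \x m).
  exact: sigma_finite_product.
have preF k : tuple_cons @^-1` (tuple_uncons @^-1` F k) = F k.
  by apply/seteqP; split => x /=; rewrite tuple_consK.
exists (fun k => tuple_uncons @^-1` F k).
  by rewrite -preimage_bigcup -UF preimage_setT.
move=> k; have [mFk Fkoo] := mF k; split.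
  by rewrite -[X in measurable X]setTI; exact: measurable_tuple_uncons.
by rewrite /lebesgue_step /pushforward preF.
Qed.

HB.instance Definition _ := Measure_isSigmaFinite.Build _ _ _
  lebesgue_step lebesgue_step_sigma_finite.

End lebesgue_tuple_step.

(* Lebesgue measure on R^n, by iterated products. *)
Fixpoint lebesgue_tuple (R : realType) (n : nat) :
    {sigma_finite_measure set (n.-tuple R) -> \bar R} :=
  match n with
  | 0 => dirac ([tuple] : 0.-tuple R)
  | n'.+1 => lebesgue_step (lebesgue_tuple R n')
  end.

Section independence.
Context {R : realType} {d : measure_display} {Omega : measurableType d}.
Variable P : probability Omega R.

Definition mutually_independent (I : finType) (F : I -> set (set Omega)) :=
  forall (J : {set I}) (A : I -> set Omega),
    (forall i, i \in J -> F i (A i)) ->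
    P (\bigcap_(i in [set` J]) A i) = (\prod_(i in J) P (A i))%E.

(* Processes are indexed by R, but only the times t >= 0 are relevant. *)
Definition process_sigma (X : R -> {RV P >-> R}) : set (set Omega) :=
  <<s \bigcup_(t in `[0, +oo[) preimage_set_system setT (X t) measurable >>.

Definition independent_increments (X : R -> {RV P >-> R}) :=
  forall (n : nat) (tau : nat -> R), 0 <= tau 0%N ->
    {homo tau : i j / (i <= j)%N >-> i <= j} ->
    mutually_independent (fun i : 'I_n => preimage_set_system setT
      (fun w => X (tau i.+1) w - X (tau i) w) measurable).

(* Continuity is required of every path, so that composing with a random time
   yields a random variable. *)
Definition standard_brownian (B : R -> {RV P >-> R}) :=
  [/\ {ae P, forall w, B 0 w = 0},
      independent_increments B,
      (forall (s t : R) (U : set R), 0 <= s -> s < t -> measurable U ->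
         P [set w | U (B t w - B s w)] = normal_prob 0 (Num.sqrt (t - s)) U)
    & forall w, {within `[0, +oo[, continuous (fun t => B t w)}].

Definition cauchy_pdf (t x : R) : R := t / (pi * (t ^+ 2 + x ^+ 2)).

Definition cadlag (f : R -> R) :=
  (forall t : R, 0 <= t -> f s @[s --> t^'+] --> f t) /\
  (forall t : R, 0 < t -> exists l : R, f s @[s --> t^'-] --> l).

Definition standard_cauchy (C : R -> {RV P >-> R}) :=
  [/\ {ae P, forall w, C 0 w = 0},
      independent_increments C,
      (forall (s t : R) (U : set R), 0 <= s -> s < t -> measurable U ->
         P [set w | U (C t w - C s w)] =
         (\int[lebesgue_measure]_(x in U) (cauchy_pdf (t - s) x)%:E)%E)
    & {ae P, forall w, cadlag (fun t => C t w)}].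

(* The index [None] stands for C and [Some j] for B_j. *)
Definition independent_processes (n : nat) (B : 'I_n -> R -> {RV P >-> R})
    (C : R -> {RV P >-> R}) :=
  mutually_independent (fun o : option 'I_n =>
    process_sigma (if o is Some j then B j else C)).

Definition J_BC (n : nat) (B : 'I_n -> R -> {RV P >-> R})
    (C : R -> {RV P >-> R}) (t : R) (w : Omega) : n.-tuple R :=
  [tuple B j `|C t w| w | j < n].

Definition joint_density (n : nat) (X : Omega -> n.-tuple R)
    (f : n.-tuple R -> \bar R) :=
  [/\ measurable_fun setT X,
      measurable_fun setT f,
      (forall x, 0 <= f x)%E
    & forall A, measurable A ->
        P (X @^-1` A) = (\int[lebesgue_tuple R n]_(x in A) f x)%E].

End independence.

Definition subordinated_density (R : realType) (n : nat) (t : R)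
    (x : n.-tuple R) (s : R) : R :=
  (\prod_(j < n) (expR (- (tnth x j ^+ 2 / (2 * s))) / Num.sqrt (2 * pi * s)))
  * (t / (t ^+ 2 + s ^+ 2)).

(* Extended-real valued: for n >= 2 the integral diverges at the origin. *)
Definition p_BC (R : realType) (n : nat) (t : R) (x : n.-tuple R) : \bar R :=
  ((2 / pi)%:E *
   \int[lebesgue_measure]_(s in [set s : R | (0 < s)%R])
     (subordinated_density t x s)%:E)%E.

Section generalized_functions.
Context {R : realType}.

Definition distr1 := (R -> R) -> R.

Definition dirac1 : distr1 := fun psi => psi 0.

Definition ddistr1 (T : distr1) : distr1 := fun psi => - T (psi^`()%classic).

Variable n : nat.
Notation V := 'rV[R]_n.

Definition distr := (V -> R) -> R.

Definition partial (j : 'I_n) (phi : V -> R) : V -> R :=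
  fun x => 'D_(delta_mx 0 j) phi x.

Definition iter_partial (s : seq 'I_n) (phi : V -> R) : V -> R :=
  foldr partial phi s.

Definition smooth (phi : V -> R) := forall s : seq 'I_n,
  continuous (iter_partial s phi) /\
  forall j x, derivable (iter_partial s phi) x (delta_mx 0 j).

Definition test_function (phi : V -> R) :=
  smooth phi /\ compact (closure [set x | phi x != 0]).

Definition regular_distr (f : n.-tuple R -> \bar R) : distr := fun phi =>
  fine (\int[lebesgue_tuple R n]_x (f x * (phi (\row_j tnth x j))%:E))%E.

Definition ddistr (j : 'I_n) (T : distr) : distr := fun phi =>
  - T (partial j phi).

Definition laplacian_distr (T : distr) : distr := fun phi =>
  \sum_(j < n) ddistr j (ddistr j T) phi.

Definition set_coord (x : V) (i : 'I_n) (u : R) : V :=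
  \row_k (if k == i then u else x 0 k).

(* The tensor product T_1(x_1) ... T_n(x_n): each T_i is applied in turn to the
   i-th variable; the result no longer depends on the base point, here 0. *)
Definition tensor_distr (T : 'I_n -> distr1) : distr := fun phi =>
  foldr (fun i (psi : V -> R) x => T i (fun u => psi (set_coord x i u)))
    phi (enum 'I_n) 0.

(* delta(x_1) ... delta''(x_j) ... delta(x_n) *)
Definition dirac_second (j : 'I_n) : distr :=
  tensor_distr (fun k => if k == j then ddistr1 (ddistr1 dirac1) else dirac1).

(* The equation holds between generalized functions of x, for each t > 0; time
   derivatives of a distribution-valued function are weak ones. *)
Definition BC_equation (p : R -> n.-tuple R -> \bar R) :=
  forall phi, test_function phi -> forall t : R, 0 < t ->
    let F s := regular_distr (p s) phi in
    [/\ derivable F t 1, derivable F^`()%classic t 1 &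
      F^`(2)%classic t =
      - (1 / 2 ^+ 2) * laplacian_distr (laplacian_distr (regular_distr (p t))) phi
      - 1 / (pi * t) * \sum_(j < n) dirac_second j phi].

Definition BC_initial (p : R -> n.-tuple R -> \bar R) :=
  forall phi, test_function phi ->
    regular_distr (p t) phi @[t --> 0^'+] --> tensor_distr (fun=> dirac1) phi.

End generalized_functions.

(* Main.v *)
(* Conditioning on |C(t)| = s, the vector B(s) is Gaussian with covariance s I,
   so integrating against the law (2/pi) t/(t^2+s^2) ds of |C(t)| gives the
   density p.  Testing p(.,t) against phi gives (2/pi) times the integral over
   s > 0 of h(s) q(t,s), where h(s) = E phi(sqrt(s) Z) with Z standard Gaussian
   and q(t,s) = t/(t^2+s^2).  Gaussian integration by parts yields the heat
   equation h' = (1/2) E (Laplacian phi)(sqrt(s) Z).  Since q is harmonic,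
   q_tt = - q_ss, and two integrations by parts in s turn the second time
   derivative into - (2/pi) times the integral of h'' q (the bilaplacian term)
   plus the boundary term - (2/pi) h'(0)/t, which is the singular one. *)

Require Import Defs.
From HB Require Import structures.
From mathcomp Require Import all_boot all_order all_algebra.
From mathcomp Require Import all_classical all_reals all_analysis.
From mathcomp Require Import measurable_realfun.

From mathcomp Require Import ring lra.

Set Implicit Arguments.
Unset Strict Implicit.
Unset Printing Implicit Defensive.

Import Order.TTheory GRing.Theory Num.Theory.
Import numFieldNormedType.Exports.

Local Open Scope classical_set_scope.
Local Open Scope ring_scope.

(** * Product Gaussian measures *)

(** For [n >= 2] the density is [+oo] at the origin, so integrals are exchanged by Tonelli for
    nonnegative integrands, and signed test functions enter through their positive and negative
    parts. Writing a Gaussian vector of variance s as sqrt(s) Z moves s from the measure into the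
    integrand, where differentiation under the integral applies. The price is the factor 1 / (2
    sqrt(s)), singular at 0; Gaussian integration by parts yields a factor sqrt(s) that cancels it.
    Hence the formula for h' extends continuously to s = 0, which gives the boundary value h'(0) a
    meaning. All derivatives of q in use are dominated by a multiple of 1 / (1 + s^2), locally
    uniformly in t > 0. The initial condition comes from s = t u, which turns q(t,s) ds into du / (1
    + u^2). On the probabilistic side the obstacle is the random time: B at |C(t)| requires joint
    measurability in time and path, for a sigma-algebra independent of C. This is where path
    continuity enters. *)

Section density.
Local Open Scope ereal_scope.
Context d (T : measurableType d) (R : realType).
Variables (mu nu : {measure set T -> \bar R}) (p : T -> R).
Hypotheses (mp : measurable_fun setT p) (p0 : forall x, (0 <= p x)%R).
Hypothesis nuE : forall A, measurable A -> nu A = \int[mu]_(x in A) (p x)%:E.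

Import HBNNSimple.

(** Both sides are monotone limits along the simple functions [f_ n]; on the level sets of these the
    claim is [nuE]. It serves both the normal law and the law of C(t). *)
Lemma ge0_integral_density (F : T -> \bar R) :
  measurable_fun setT F -> (forall x, 0 <= F x) ->
  \int[nu]_x F x = \int[mu]_x ((p x)%:E * F x).
Proof.
move=> mF F0; pose f_ := nnsfun_approx measurableT mF.
transitivity (limn (fun n => \int[nu]_x (f_ n x)%:E)).
  rewrite -monotone_convergence//.
  - apply: eq_integral => y _; apply/esym/cvg_lim => //.
    exact: cvg_nnsfun_approx.
  - by move=> n; exact/measurable_EFinP/measurable_funP.
  - by move=> n y _; rewrite lee_fin.
  - by move=> y _ m n mn; rewrite lee_fin; exact/lefP/nd_nnsfun_approx.
rewrite [X in limn X](_ : _ =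
    (fun n => \int[mu]_x ((p x)%:E * (f_ n x)%:E))).
  rewrite -monotone_convergence//; last 3 first.
  - move=> n; apply: emeasurable_funM; first exact/measurable_EFinP.
    exact/measurable_EFinP/measurable_funP.
  - by move=> n x _; rewrite mule_ge0 ?lee_fin.
  - move=> x _ m n mn; apply: lee_wpmul2l; first by rewrite lee_fin.
    by rewrite lee_fin; exact/lefP/nd_nnsfun_approx.
  apply: eq_integral => x _; apply/cvg_lim => //; apply: cvgeZl => //.
  exact: cvg_nnsfun_approx.
apply/funext => n.
have mf r : measurable (f_ n @^-1` [set r]) by [].
transitivity (\sum_(k \in range (f_ n))
    \int[nu]_x (k * \1_(f_ n @^-1` [set k]) x)%:E).
  under eq_integral do rewrite fimfunE -fsumEFin//.
  rewrite ge0_integral_fsum//.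
  - by move=> y; exact/measurable_EFinP/measurable_funM.
  - by move=> y x _; rewrite EFinM nnfun_muleindic_ge0.
transitivity (\sum_(k \in range (f_ n))
    \int[mu]_x ((p x)%:E * (k * \1_(f_ n @^-1` [set k]) x)%:E)); last first.
  rewrite -ge0_integral_fsum//.
  - apply: eq_integral => x _; rewrite -ge0_mule_fsumr.
      by rewrite fsumEFin// -fimfunE.
    by move=> r; rewrite EFinM nnfun_muleindic_ge0.
  - move=> r; apply/measurable_EFinP/measurable_funM => //.
    exact/measurable_funM.
  - by move=> r x _; apply: mule_ge0; rewrite ?lee_fin// -lee_fin EFinM nnfun_muleindic_ge0.
apply: eq_fsbigr => r; rewrite inE => -[y _ <-].
rewrite integralZl_indic_nnsfun// integral_indic// setIT nuE//.
transitivity (\int[mu]_x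
    ((f_ n y)%:E * (EFin \o (p \_ (f_ n @^-1` [set f_ n y]))) x)); last first.
  by apply: eq_integral => x _; rewrite /= patch_indic -!EFinM/= mulrCA.
rewrite ge0_integralZl//; last 3 first.
- by apply/measurable_EFinP; rewrite patch_indic; exact: measurable_funM.
- by move=> x _; rewrite lee_fin /= patchE; case: ifP.
- by rewrite lee_fin.
rewrite integral_mkcond; congr (_ * _).
by apply: eq_integral => x _; rewrite /= !patchE; case: ifP.
Qed.

Lemma integral_density (F : T -> \bar R) : measurable_fun setT F ->
  \int[nu]_x F x = \int[mu]_x ((p x)%:E * F x).
Proof.
move=> mF; rewrite integralE [RHS]integralE.
have mFp := measurable_funepos mF; have mFn := measurable_funeneg mF.
rewrite !ge0_integral_density//.
congr (_ - _); apply: eq_integral => x _.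
  by rewrite !funeposE maxe_pMr ?lee_fin// mule0.
by rewrite !funenegE -muleN maxe_pMr ?lee_fin// mule0.
Qed.

End density.

HB.instance Definition _ (R : realType) n :=
  isMeasurableFun.Build _ _ (measurableTypeR R * n.-tuple R)%type
    (n.+1.-tuple R) (@tuple_cons R n) (@measurable_tuple_cons R n).

(** The standard Gaussian law is pushed forward along [tuple_cons] just as [lebesgue_tuple] is, so
    that the two can be compared by induction on [n]. *)
Fixpoint gauss_tuple (R : realType) (n : nat) : probability (n.-tuple R) R :=
  match n with
  | 0 => dirac ([tuple] : 0.-tuple R)
  | n'.+1 => distribution
      (@normal_prob R 0 1 \x gauss_tuple R n')%E (@tuple_cons R n')
  end.

Lemma ge0_integral_lebesgue_tupleS (R : realType) n
    (F : n.+1.-tuple R -> \bar R) :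
  measurable_fun setT F -> (forall x, 0 <= F x)%E ->
  (\int[lebesgue_tuple R n.+1]_x F x =
   \int[lebesgue_measure]_a \int[lebesgue_tuple R n]_x F (tuple_cons (a, x)))%E.
Proof.
move=> mF F0.
have mFc := measurableT_comp mF (@measurable_tuple_cons R n).
rewrite -(@fubini_tonelli1 _ _ _ _ _ _ _ (F \o @tuple_cons R n))//.
rewrite -(@ge0_integral_pushforward _ _ _ _ _ _ (@measurable_tuple_cons R n)
  _ setT F)//.
by move=> p; exact: F0.
Qed.

Lemma ge0_integral_gauss_tupleS (R : realType) n
    (F : n.+1.-tuple R -> \bar R) :
  measurable_fun setT F -> (forall x, 0 <= F x)%E ->
  (\int[gauss_tuple R n.+1]_x F x =
   \int[normal_prob 0 1]_a \int[gauss_tuple R n]_x F (tuple_cons (a, x)))%E.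
Proof.
move=> mF F0.
have mFc := measurableT_comp mF (@measurable_tuple_cons R n).
rewrite -(@fubini_tonelli1 _ _ _ _ _ _ _ (F \o @tuple_cons R n))//.
by rewrite ge0_integral_distribution.
by move=> p; exact: F0.
Qed.

(** * Dilations of Lebesgue and Gaussian measures *)

Section scaling.
Context {R : realType}.
Local Open Scope ereal_scope.
Variables (c : R) (c0 : (0 < c)%R).

Let cn : {nonneg R} := NngNum (ltW c0).

Let mc : measurable_fun setT (fun x : measurableTypeR R => (c * x)%R : measurableTypeR R).
Proof. exact: measurable_funM. Qed.

(** The image of Lebesgue measure under x -> c x, multiplied by c, gives each interval its length,
    hence is Lebesgue measure by uniqueness. *)
Lemma ge0_integral_scale (F : R -> \bar R) :
  measurable_fun setT F -> (forall x, 0 <= F x) ->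
  \int[lebesgue_measure]_x F x = \int[lebesgue_measure]_x (c%:E * F (c * x)%R).
Proof.
move=> mF F0.
pose nu : {measure set (measurableTypeR R) -> \bar R} := mscale cn
  (pushforward (@lebesgue_measure R)
    (fun x : measurableTypeR R => (c * x)%R : measurableTypeR R)).
transitivity (\int[nu mc]_x F x).
  apply: eq_measure_integral => A mA _.
  apply: lebesgue_measure_unique => // _ [[a b]] _ <-.
  rewrite /= /nu/= /mscale/= /pushforward.
  rewrite (_ : _ @^-1` _ = `](a / c)%R, (b / c)%R]%classic).
    rewrite !lebesgue_measure_itv/= !lte_fin ltr_pM2r ?invr_gt0//.
    case: ifPn => _; last by rewrite mule0.
    by rewrite -!EFinD -EFinM -mulrBl mulrC divfK// gt_eqF.
  apply/seteqP; split => x /=; rewrite !in_itv/= ltr_pdivrMr// ler_pdivlMr//;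
    by rewrite (mulrC x).
rewrite ge0_integral_mscale//= ge0_integral_pushforward//= ge0_integralZl//.
- exact: measurableT_comp.
- by rewrite lee_fin ltW.
Qed.

End scaling.

Lemma ge0_integral_normal_scale (R : realType) (c : R) (F : R -> \bar R) :
  0 < c -> measurable_fun setT F -> (forall x, 0 <= F x)%E ->
  (\int[lebesgue_measure]_x ((normal_pdf 0 c x)%:E * F x) =
   \int[normal_prob 0 1]_x F (c * x)%R)%E.
Proof.
move=> c0 mF F0; rewrite (ge0_integral_scale c0); last 2 first.
- apply: emeasurable_funM => //; apply/measurable_EFinP.
  exact: measurable_normal_pdf.
- by move=> x; rewrite mule_ge0// lee_fin normal_pdf_ge0.
rewrite (@ge0_integral_density _ _ R lebesgue_measure (normal_prob 0 1)
    (normal_pdf 0 1))//; last 3 first.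
- exact: measurable_normal_pdf.
- by move=> x; exact: normal_pdf_ge0.
- by apply: (measurableT_comp mF); exact: measurable_funM.
apply: eq_integral => x _; rewrite muleA -EFinM; congr (_%:E * _)%E.
rewrite !normal_pdfE ?oner_eq0 ?gt_eqF// /normal_peak /normal_fun !subr0.
rewrite expr1n mul1r mulrA; congr (_ * _).
  rewrite -mulrnAr sqrtrM ?sqr_ge0// sqrtr_sqr gtr0_norm// invfM mulrA.
  by rewrite divff ?gt_eqF// mul1r.
congr expR; rewrite exprMn; field.
by rewrite gt_eqF.
Qed.

Definition tuple_scale (R : realType) n (c : R) (x : n.-tuple R) : n.-tuple R :=
  [tuple c * tnth x i | i < n].

Lemma tuple_scale_cons (R : realType) n (c a : R) (x : n.-tuple R) :
  tuple_scale c (tuple_cons (a, x)) = tuple_cons (c * a, tuple_scale c x).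
Proof.
apply: eq_from_tnth => i; rewrite tnth_mktuple /tuple_cons/=.
case: (unliftP ord0 i) => [j|] ->; first by rewrite !tnthS tnth_mktuple.
by rewrite !tnth0.
Qed.

Lemma measurable_tuple_scale (R : realType) n (c : R) :
  measurable_fun setT (@tuple_scale R n c).
Proof.
apply/measurable_fun_tnthP => i.
rewrite (_ : _ \o _ = (fun x : n.-tuple R => c * tnth x i)).
  by apply: measurable_funM => //; exact: measurable_tnth.
by apply/funext => x /=; rewrite tnth_mktuple.
Qed.

Lemma measurable_prod_normal_pdf (R : realType) n (c : R) :
  measurable_fun setT
    (fun x : n.-tuple R => \prod_(j < n) normal_pdf 0 c (tnth x j)).
Proof.
apply: measurable_prod => j _.
apply: measurableT_comp; first exact: measurable_normal_pdf.
exact: measurable_tnth.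
Qed.

(** This moves the standard deviation from the density into the integrand. Tonelli splits off the
    first coordinate, which is rescaled by the one-dimensional case; the induction hypothesis treats
    the others. *)
Lemma ge0_integral_gauss_tuple_scale (R : realType) n (c : R)
    (F : n.-tuple R -> \bar R) :
  0 < c -> measurable_fun setT F -> (forall x, 0 <= F x)%E ->
  (\int[lebesgue_tuple R n]_x
     ((\prod_(j < n) normal_pdf 0 c (tnth x j))%:E * F x) =
   \int[gauss_tuple R n]_x F (tuple_scale c x))%E.
Proof.
move=> c0; elim: n F => [|n IHn] F mF F0.
  have mFs := measurableT_comp mF (@measurable_tuple_scale R 0 c).
  rewrite !integral_dirac//; last first.
    apply: emeasurable_funM => //; apply/measurable_EFinP.
    exact: measurable_prod_normal_pdf.
  by rewrite big_ord0 mul1e; congr (_ * F _)%E; exact/esym/tuple0.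
have p0 k (x : k.-tuple R) : (0 <= \prod_(j < k) normal_pdf 0 c (tnth x j))%R.
  by apply: prodr_ge0 => j _; exact: normal_pdf_ge0.
have mFc := measurableT_comp mF (@measurable_tuple_cons R n).
have mFs := measurableT_comp mF (@measurable_tuple_scale R n.+1 c).
have mFcs : measurable_fun setT (fun p : measurableTypeR R * n.-tuple R =>
    F (tuple_cons (p.1, tuple_scale c p.2))).
  apply: (measurableT_comp mFc); apply: measurable_fun_pair => //=.
  by apply: (measurableT_comp (@measurable_tuple_scale R n c)).
rewrite ge0_integral_lebesgue_tupleS; last 2 first.
- apply: emeasurable_funM => //; apply/measurable_EFinP.
  exact: measurable_prod_normal_pdf.
- by move=> x; rewrite mule_ge0// lee_fin.
rewrite ge0_integral_gauss_tupleS//.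
under [RHS]eq_integral do under eq_integral do rewrite tuple_scale_cons.
rewrite -(ge0_integral_normal_scale c0 (F := fun a =>
  \int[gauss_tuple R n]_x F (tuple_cons (a, tuple_scale c x))))%E; last 2 first.
- exact: (@measurable_fun_fubini_tonelli_F _ _ _ _ _ _
    (fun p : measurableTypeR R * n.-tuple R =>
      F (tuple_cons (p.1, tuple_scale c p.2)))).
- by move=> a; exact: integral_ge0.
apply: eq_integral => a _.
rewrite /= -(IHn (fun x => F (tuple_cons (a, x)))); last 2 first.
- exact: measurable_fun_pair2 mFc.
- by move=> x; exact: F0.
rewrite -ge0_integralZl//; last 3 first.
- apply: emeasurable_funM; last exact: measurable_fun_pair2 mFc.
  by apply/measurable_EFinP; exact: measurable_prod_normal_pdf.
- by move=> x _; rewrite mule_ge0// lee_fin.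
- by rewrite lee_fin normal_pdf_ge0.
apply: eq_integral => x _; rewrite muleA -EFinM; congr (_%:E * _)%E.
rewrite big_ord_recl; congr (_ * _).
by apply: eq_bigr => j _; rewrite /tuple_cons/= tnthS.
Qed.

Lemma measurable_invr (R : realType) : measurable_fun setT (@GRing.inv R).
Proof.
(* x^-1 = x (x^2)^-1 also holds at 0, where both sides are 0. *)
rewrite (_ : GRing.inv = fun x : R => x * (x ^+ 2) `^ (-1)).
  apply: measurable_funM => //; apply: (measurableT_comp (@measurable_powR R (-1))).
  exact: exprn_measurable.
apply/funext => x; rewrite powR_inv1 ?sqr_ge0//.
have [->|x0] := eqVneq x 0; first by rewrite invr0 mul0r.
by rewrite expr2 invfM mulrA divff// mul1r.
Qed.

Lemma measurable_fun_sqrt (R : realType) : measurable_fun setT (@Num.sqrt R).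
Proof. by apply: continuous_measurable_fun; exact: sqrt_continuous. Qed.

Lemma normal_pdf_sqrt (R : realType) (s x : R) : 0 < s ->
  normal_pdf 0 (Num.sqrt s) x =
  expR (- (x ^+ 2 / (2 * s))) / Num.sqrt (2 * pi * s).
Proof.
move=> s0; rewrite normal_pdfE ?gt_eqF ?sqrtr_gt0//.
rewrite /normal_peak /normal_fun subr0 sqr_sqrtr ?ltW// mulrC.
by congr (expR _ / Num.sqrt _); [field; rewrite gt_eqF|ring].
Qed.

Lemma subordinated_densityE (R : realType) n (t s : R) (x : n.-tuple R) :
  0 < s -> subordinated_density t x s =
  (\prod_(j < n) normal_pdf 0 (Num.sqrt s) (tnth x j)) *
  (t / (t ^+ 2 + s ^+ 2)).
Proof.
move=> s0; rewrite /subordinated_density; congr (_ * _).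
by apply: eq_bigr => j _; rewrite normal_pdf_sqrt.
Qed.

Lemma subordinated_density_ge0 (R : realType) n (t s : R) (x : n.-tuple R) :
  0 < t -> 0 <= subordinated_density t x s.
Proof.
move=> t0; rewrite mulr_ge0 ?prodr_ge0//.
  by rewrite divr_ge0 ?(ltW t0)// addr_ge0 ?sqr_ge0.
Qed.

Lemma measurable_subordinated_density (R : realType) n (t : R) :
  measurable_fun setT (fun p : n.-tuple R * measurableTypeR R =>
    subordinated_density t p.1 p.2).
Proof.
apply: measurable_funM.
  apply: measurable_prod => j _; apply: measurable_funM.
    apply: (measurableT_comp (@measurable_expR R)).
    apply: measurable_funN; apply: measurable_funM.
      apply: measurable_funX.
      by apply: (measurableT_comp (measurable_tnth j)).
    apply: (measurableT_comp (@measurable_invr R)).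
    exact: measurable_funM.
  apply: (measurableT_comp (@measurable_invr R)).
  apply: (measurableT_comp (@measurable_fun_sqrt R)).
  exact: measurable_funM.
apply: measurable_funM => //; apply: (measurableT_comp (@measurable_invr R)).
apply: measurable_funD => //; exact: measurable_funX.
Qed.

(** * Testing the density against nonnegative functions *)

Section p_BC_integral.
Context {R : realType} (n : nat) (t : R).
Hypothesis t0 : 0 < t.
Local Open Scope ereal_scope.
Local Notation pos := [set s : R | (0 < s)%R].

(** The constraint s > 0 is put into the integrand as an indicator, so that Tonelli applies on the
    whole product and [p_BC] is the partial integral of one function. *)
Let D (p : n.-tuple R * measurableTypeR R) : \bar R :=
  (2 / pi * (subordinated_density t p.1 p.2 * \1_pos p.2))%:E.

Let mpos : measurable (pos : set (measurableTypeR R)).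
Proof.
rewrite (_ : pos = `]0%R, +oo[%classic)//.
by apply/seteqP; split => s /=; rewrite in_itv/= andbT.
Qed.

Let mD : measurable_fun setT D.
Proof.
apply/measurable_EFinP/measurable_funM => //; apply: measurable_funM.
  exact: measurable_subordinated_density.
have m1 : measurable_fun setT (\1_pos : measurableTypeR R -> R).
  exact: measurable_indic.
exact: (measurableT_comp m1 measurable_snd).
Qed.

Let D_ge0 p : 0 <= D p.
Proof.
rewrite lee_fin mulr_ge0 ?divr_ge0 ?pi_ge0//.
by rewrite mulr_ge0 ?subordinated_density_ge0.
Qed.

Let p_BCE x : @p_BC R n t x = \int[lebesgue_measure]_s D (x, s).
Proof.
have m1 : measurable_fun setT
    (fun s : measurableTypeR R => (subordinated_density t x s)%:E).
  apply/measurable_EFinP.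
  exact: (measurable_fun_pair2 x (@measurable_subordinated_density R n t)).
rewrite /p_BC -ge0_integralZl//; last 3 first.
- exact: measurable_funTS.
- by move=> s _; rewrite lee_fin subordinated_density_ge0.
- by rewrite lee_fin divr_ge0 ?pi_ge0.
rewrite integral_mkcond epatch_indic; apply: eq_integral => s _.
by rewrite -!EFinM; congr EFin; exact/esym/mulrA.
Qed.

Lemma measurable_p_BC : measurable_fun setT (@p_BC R n t).
Proof.
rewrite (_ : @p_BC R n t = fubini_F lebesgue_measure D).
  exact: measurable_fun_fubini_tonelli_F.
by apply/funext => x; rewrite p_BCE.
Qed.

Lemma p_BC_ge0 x : 0 <= @p_BC R n t x.
Proof. by rewrite p_BCE; apply: integral_ge0. Qed.

(** Tonelli puts the integral in x inside; for fixed s the product of normal densities becomes a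
    dilation of the standard Gaussian vector. Nonnegativity of [psi] makes this valid with no
    integrability condition. *)
Lemma ge0_integral_p_BC (psi : n.-tuple R -> \bar R) :
  measurable_fun setT psi -> (forall x, 0 <= psi x) ->
  \int[lebesgue_tuple R n]_x (@p_BC R n t x * psi x) =
  \int[lebesgue_measure]_(s in pos)
    ((2 / pi * (t / (t ^+ 2 + s ^+ 2)))%:E *
     \int[gauss_tuple R n]_z psi (tuple_scale (Num.sqrt s) z)).
Proof.
move=> mpsi psi0.
have mDpsi : measurable_fun setT
    (fun p : n.-tuple R * measurableTypeR R => D p * psi p.1).
  by apply: emeasurable_funM => //; exact: (measurableT_comp mpsi).
transitivity (\int[lebesgue_tuple R n]_x \int[lebesgue_measure]_s
    (D (x, s) * psi x)).
  apply: eq_integral => x _; rewrite ge0_integralZr ?p_BCE//.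
  exact: measurable_fun_pair2 mD.
rewrite (@fubini_tonelli _ _ _ _ _ (lebesgue_tuple R n) lebesgue_measure
  (fun p : n.-tuple R * measurableTypeR R => D p * psi p.1))//; last first.
  by move=> p; rewrite mule_ge0.
rewrite [RHS]integral_mkcond; apply: eq_integral => s _.
rewrite patchE; case: ifPn => [|/negPf sN]; last first.
  by rewrite integral0_eq// => x _; rewrite /D/= indicE sN !mulr0 mul0e.
rewrite inE/= => s0; have ss0 : (0 < Num.sqrt s)%R by rewrite sqrtr_gt0.
rewrite -ge0_integral_gauss_tuple_scale// -ge0_integralZl//; last 3 first.
- apply: emeasurable_funM => //; apply/measurable_EFinP.
  exact: measurable_prod_normal_pdf.
- move=> x _; rewrite mule_ge0// lee_fin prodr_ge0// => j _.
  exact: normal_pdf_ge0.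
- rewrite lee_fin mulr_ge0 ?divr_ge0 ?pi_ge0 ?(ltW t0)//.
  by rewrite addr_ge0 ?sqr_ge0.
apply: eq_integral => x _; rewrite muleA; congr (_ * _).
rewrite /D/= -EFinM subordinated_densityE// indicE mem_set//= mulr1.
by rewrite [X in (_ * X)%R]mulrC mulrA.
Qed.

End p_BC_integral.

(** * Measurability and uniqueness on tuples *)

Section caratheodory.
Context {R : realType} {d} {T : measurableType d}.
Variable f : R -> T -> R.
Hypotheses (cf : forall w, continuous (f ^~ w))
  (mf : forall a, measurable_fun setT (f a)).

(** Rounding down to multiples of 1/(k+1). On each cell [f (grid k a) w] depends on [w] alone. *)
Let grid k (a : R) : R := (Num.floor (k.+1%:R * a))%:~R / k.+1%:R.

Let grid_cvg a : grid k a @[k --> \oo] --> a.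
Proof.
apply/cvgrPdist_le => e e0; near=> k.
have k0 : 0 < k.+1%:R :> R by rewrite ltr0n.
rewrite (_ : a - grid k a =
  (k.+1%:R * a - (Num.floor (k.+1%:R * a))%:~R) / k.+1%:R); last first.
  by rewrite /grid mulrBl mulrAC divff ?gt_eqF// mul1r.
rewrite normrM [X in _ * X]gtr0_norm ?invr_gt0// ger0_norm ?subr_ge0 ?floor_le//.
apply: (@le_trans _ _ (k.+1%:R^-1)).
  rewrite ler_piMl ?invr_ge0 ?(ltW k0)// lerBlDl ltW//.
  by have := floorD1_gt (k.+1%:R * a); rewrite intrD.
rewrite -[leRHS]invrK lef_pV2 ?posrE ?invr_gt0//.
near: k; exists (Num.trunc e^-1).+1 => // k /= kN.
apply: ltW; apply: lt_le_trans (truncnS_gt _) _.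
by rewrite ler_nat (leq_trans kN)// leqW.
Unshelve. all: by end_near. Qed.

(** A function continuous in one variable and measurable in the other is the pointwise limit of its
    versions with the first variable rounded, and these are measurable cell by cell. *)
Lemma measurable_fun_caratheodory :
  measurable_fun setT (fun p : measurableTypeR R * T => f p.1 p.2).
Proof.
apply: (@measurable_fun_cvg _ _ _ _ (fun k p => f (grid k p.1) p.2)); last first.
  move=> [a w] _ /=; apply: (cvg_comp (grid ^~ a) (f ^~ w)).
    exact: grid_cvg.
  exact: cf.
move=> k _ Y mY; rewrite setTI.
(* The preimage is a countable union of rectangles: one cell of the grid times a measurable set of
   [T]. *)
rewrite (_ : _ @^-1` Y = \bigcup_(m in [set: int])
    (`[m%:~R / k.+1%:R, (m + 1)%:~R / k.+1%:R[%classic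
     `*` (f (m%:~R / k.+1%:R) @^-1` Y))).
  apply: countable_bigcupT_measurable => [|m].
    exact: countableP.
  by apply: measurableX => //; rewrite -[X in measurable X]setTI; exact: mf.
have k0 : 0 < k.+1%:R :> R by rewrite ltr0n.
apply/seteqP; split => [[a w] /= Ya|[a w] [m _ [/= am Ym]]].
  exists (Num.floor (k.+1%:R * a)) => //; split => //=.
  rewrite in_itv/= ler_pdivrMr// ltr_pdivlMr// (mulrC a) floor_le/=.
  exact: floorD1_gt.
rewrite /grid (_ : Num.floor (k.+1%:R * a) = m)//.
apply/eqP; rewrite floor_eq; move: am.
by rewrite in_itv/= ler_pdivrMr// ltr_pdivlMr// (mulrC a).
Qed.

End caratheodory.

Definition tuple_set (T : Type) n (z : n.-tuple T) (j : 'I_n) (u : T) : n.-tuple T :=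
  [tuple if i == j then u else tnth z i | i < n].

Lemma tnth_tuple_set (T : Type) n (z : n.-tuple T) (j : 'I_n) (u : T) i :
  tnth (tuple_set z j u) i = if i == j then u else tnth z i.
Proof. by rewrite tnth_mktuple. Qed.

(** Test functions live on row vectors and integrals on tuples; separate continuity passes from one
    to the other without comparing topologies. By induction on [n], the function is continuous in
    the first coordinate and measurable in the rest, so the Carathéodory criterion applies. *)
Lemma measurable_separately_continuous (R : realType) n
    (f : n.-tuple R -> R) :
  (forall z j, continuous (fun u => f (tuple_set z j u))) ->
  measurable_fun setT f.
Proof.
elim: n f => [|n IHn] f cf.
  rewrite (_ : f = cst (f [tuple])); first exact: measurable_cst.
  by apply/funext => x; rewrite /= [x]tuple0.
have mf : measurable_fun setT
    (fun p : measurableTypeR R * n.-tuple R => f (tuple_cons (p.1, p.2))).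
  apply: (measurable_fun_caratheodory (f := fun a w => f (tuple_cons (a, w)))).
    move=> w; rewrite (_ : (fun _ => _) =
        (fun u => f (tuple_set (tuple_cons (0, w)) ord0 u))); first exact: cf.
    apply/funext => u; congr f; apply: eq_from_tnth => i.
    rewrite tnth_tuple_set /tuple_cons/=.
    by case: (unliftP ord0 i) => [j|] ->; rewrite ?tnthS// tnth0.
  move=> a; apply: IHn => z j.
  rewrite (_ : (fun _ => _) =
      (fun u => f (tuple_set (tuple_cons (a, z)) (lift ord0 j) u))).
    exact: cf.
  apply/funext => u; congr f; apply: eq_from_tnth => i.
  rewrite tnth_tuple_set /tuple_cons/=.
  case: (unliftP ord0 i) => [k|] ->; last by rewrite !tnth0.
  by rewrite !tnthS tnth_tuple_set (inj_eq lift_inj).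
rewrite (_ : f =
    (fun p : measurableTypeR R * n.-tuple R => f (tuple_cons (p.1, p.2)))
      \o @tuple_uncons R n).
  exact: (measurableT_comp mf (@measurable_tuple_uncons R n)).
by apply/funext => x /=; rewrite -[in LHS](tuple_unconsK x) /tuple_uncons.
Qed.

Definition box (T : Type) n (A : 'I_n -> set T) : set (n.-tuple T) :=
  [set x | forall i, A i (tnth x i)].

Lemma measurable_box (R : realType) n (A : 'I_n -> set R) :
  (forall i, measurable (A i)) -> measurable (box A).
Proof.
move=> mA.
rewrite (_ : box A = \bigcap_(i in [set: 'I_n]) ((@tnth n R)^~ i @^-1` A i)).
  apply: fin_bigcap_measurable => // i _; rewrite -[X in measurable X]setTI.
  exact: measurable_tnth.
by apply/seteqP; split => x xA i; [move=> _|]; exact: xA.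
Qed.

(** Boxes are stable under intersection and generate the product sigma-algebra, so two probabilities
    that agree on them are equal. *)
Lemma tuple_measure_unique (R : realType) n
    (m1 m2 : probability (n.-tuple R) R) :
  (forall A : 'I_n -> set R, (forall i, measurable (A i)) ->
     m1 (box A) = m2 (box A)) ->
  forall X, measurable X -> m1 X = m2 X.
Proof.
move=> m12 X mX.
apply: (measure_unique
  [set box A | A in [set A : 'I_n -> set R | forall i, measurable (A i)]]
  (fun=> setT)) => //.
- apply/seteqP; split; last first.
    apply: smallest_sub; first exact: sigma_algebra_measurable.
    by move=> _ [A mA <-]; exact: measurable_box.
  apply: smallest_sub; first exact: smallest_sigma_algebra.
  rewrite -bigcup_seq => _ [i _ [A mA <-]]; apply: sub_sigma_algebra.
  (* A generator constrains one coordinate only: it is the box whose other sides are the whole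
     line. *)
  exists (fun k => if k == i then A else setT) => [k|]; first by case: ifP.
  rewrite setTI; apply/seteqP; split => x /=; first by move/(_ i); rewrite eqxx.
  by move=> Ax k; case: eqP => // ->.
- move=> _ _ [A mA <-] [B mB <-]; exists (fun i => A i `&` B i).
    by move=> i; exact: measurableI.
  by apply/seteqP; split => x /=; [move=> AB; split => i; case: (AB i)|
    move=> [xA xB] i; split; [exact: xA|exact: xB]].
- move=> _; exists (fun=> setT) => //.
  by apply/seteqP; split.
- by rewrite bigcup_const.
- by move=> _ [A mA <-]; exact: m12.
- by move=> k; rewrite /= probability_setT ltry.
Qed.

Lemma gauss_tuple_box (R : realType) n (A : 'I_n -> set R) :
  (forall i, measurable (A i)) ->
  (gauss_tuple R n (box A) = \prod_(i < n) normal_prob 0 1 (A i))%E.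
Proof.
elim: n A => [|n IHn] A mA.
  by rewrite big_ord0 /= diracE mem_set// => -[].
rewrite big_ord_recl -IHn// -product_measure1E//; last exact: measurable_box.
rewrite /= /distribution /pushforward/=; congr (_ _).
apply/seteqP; split => -[a x] /=; rewrite /box/=.
  move=> Aax; split; first by have := Aax ord0; rewrite tnth0.
  by move=> i; have := Aax (lift ord0 i); rewrite tnthS.
by move=> [Aa Ax] i; case: (unliftP ord0 i) => [j|] ->; rewrite ?tnthS ?tnth0.
exact: mA.
Qed.

(* Coordinate j can be integrated separately without reordering the coordinates
   of the recursively defined product measure. *)
Section resampling.
Context {R : realType} (n : nat) (j : 'I_n).
Local Open Scope ereal_scope.

Let re (p : n.-tuple R * measurableTypeR R) : n.-tuple R := tuple_set p.1 j p.2.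

Let mre : measurable_fun setT re.
Proof.
apply/measurable_fun_tnthP => i; have [->|ij] := eqVneq i j.
  rewrite (_ : _ \o _ = snd)//.
  by apply/funext => p; rewrite /= tnth_tuple_set eqxx.
rewrite (_ : _ \o _ = (@tnth n R)^~ i \o fst).
  by apply: measurableT_comp => //; exact: measurable_tnth.
by apply/funext => p; rewrite /= tnth_tuple_set (negbTE ij).
Qed.

HB.instance Definition _ := isMeasurableFun.Build _ _
  (n.-tuple R * measurableTypeR R)%type (n.-tuple R) re mre.

(** Overwriting coordinate [j] with an independent standard normal variable does not change the law,
    as one checks on boxes. Fubini then isolates the integral in the new variable. *)
Lemma integral_gauss_tuple_resample (F : n.-tuple R -> \bar R) :
  (gauss_tuple R n).-integrable setT F ->
  \int[gauss_tuple R n]_z F z =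
  \int[gauss_tuple R n]_z \int[normal_prob 0 1]_u F (tuple_set z j u).
Proof.
move=> iF; have mF := measurable_int _ iF.
pose m := distribution (gauss_tuple R n \x @normal_prob R 0 1) re.
have mE A : measurable A -> gauss_tuple R n A = m A.
  move=> mA; apply: tuple_measure_unique => // B mB.
  rewrite gauss_tuple_box// /m /distribution /pushforward/=.
  (* The old coordinate [j] is discarded, so it is unconstrained; the constraint [B j] falls on the
     fresh variable. *)
  pose B' (i : 'I_n) : set R := if i == j then setT else B i.
  have mB' i : measurable (B' i) by rewrite /B'; case: ifP.
  rewrite (_ : re @^-1` _ = box B' `*` B j).
    rewrite product_measure1E; [|exact: measurable_box|exact: mB].
    transitivity ((\prod_(i < n) normal_prob 0 1 (B' i)) *
        normal_prob 0 1 (B j)); last by rewrite -gauss_tuple_box.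
    rewrite (bigD1 j)//= [in RHS](bigD1 j)//= [in RHS]/B' eqxx.
    rewrite [X in X * _ * _]probability_setT mul1e muleC; congr (_ * _).
    by apply: eq_bigr => i /negbTE ij; rewrite /B' ij.
  apply/seteqP; split => -[z u] /=; rewrite /box/=.
    move=> zu; split; last by have := zu j; rewrite tnth_tuple_set eqxx.
    move=> i; have := zu i; rewrite tnth_tuple_set /B'.
    by case: eqP.
  move=> [zB' uB] i; have := zB' i; rewrite tnth_tuple_set /B'.
  by case: eqP => [->|].
have iFm : (gauss_tuple R n \x @normal_prob R 0 1).-integrable setT (F \o re).
  apply/integrableP; split; first exact: measurableT_comp.
  rewrite -(@ge0_integral_distribution _ _ _ _ _ _ re (abse \o F))//=; last first.
    exact: measurableT_comp.
  rewrite (eq_measure_integral (gauss_tuple R n)) => [|A mA _]; last first.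
    exact/esym/mE.
  by have /integrableP[] := iF.
rewrite (eq_measure_integral m) => [|A mA _]; last exact: mE.
rewrite integral_distribution//.
by rewrite -(integral12_prod_meas1 iFm).
Qed.

End resampling.

(** * Test functions *)

Section directional_derivative.
Context {R : realType} {V : normedModType R}.
Implicit Types (f : V -> R) (x y v w e : V).

Lemma is_derive_line f y e (u : R) : derivable f (u *: e + y) e ->
  is_derive u 1 (fun r : R => f (r *: e + y)) ('D_e f (u *: e + y)).
Proof.
have E : (fun h : R => h^-1 *: (f ((h *: (1 : R) + u) *: e + y) - f (u *: e + y)))
    = (fun h : R => h^-1 *: (f (h *: e + (u *: e + y)) - f (u *: e + y))).
  by apply/funext => h; rewrite [h *: 1]mulr1 scalerDl addrA.
move=> df; apply: DeriveDef; first by rewrite /derivable E.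
by rewrite /derive E.
Qed.

(** The mean value theorem on the line through [y], with either sign of [u]; the point [xi] is only
    located by its modulus, which is all that the continuity argument below requires. *)
Lemma line_mvt f y e (u : R) : (forall z, derivable f z e) ->
  exists2 xi, `|xi| <= `|u| & f (u *: e + y) - f y = u * 'D_e f (xi *: e + y).
Proof.
move=> df; pose g r := f (r *: e + y).
have dg (r : R) : is_derive r 1 g ('D_e f (r *: e + y)) by exact: is_derive_line.
have cg (A : set R) : {within A, continuous g}.
  apply: continuous_subspaceT => r.
  by apply/differentiable_continuous/derivable1_diffP; exact: ex_derive.
have g0 : f y = g 0 by rewrite /g scale0r add0r.
have [u0|u0|u0] := ltgtP 0 u.
- have [xi xiu] := MVT u0 (fun r _ => dg r) (cg _).
  rewrite subr0 mulrC g0 => guE; exists xi => //.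
  move: xiu; rewrite in_itv/= => /andP[xi0 xiu].
  by rewrite !gtr0_norm// ltW.
- have [xi xiu] := MVT u0 (fun r _ => dg r) (cg _).
  rewrite sub0r mulrN mulrC g0 => guE; exists xi.
    move: xiu; rewrite in_itv/= => /andP[uxi xi0].
    by rewrite !ltr0_norm// lerN2 ltW.
  by rewrite -[LHS]opprB guE opprK.
- by exists 0; rewrite ?normr0// -u0 mul0r scale0r add0r subrr.
Qed.

(** Moving by h (w + c e) is split into a step along [w], where the derivative at [x] is given, and
    a step along [e] from the displaced point, where the mean value theorem and continuity of the
    derivative along [e] apply. *)
Lemma is_derive_add_direction f x w e (c dw : R) :
  is_derive x w f dw -> (forall z, derivable f z e) ->
  {for x, continuous (fun z => 'D_e f z)} ->
  is_derive x (w + c *: e) f (dw + c * 'D_e f x).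
Proof.
move=> [dfw Dfw] dfe ce.
suff E : h^-1 *: (f (h *: (w + c *: e) + x) - f x) @[h --> 0^'] -->
    dw + c * 'D_e f x.
  by apply: DeriveDef; [apply/cvg_ex; eexists; exact: E|exact/cvg_lim].
rewrite (_ : (fun h => _) = (fun h => h^-1 *: (f (h *: w + x) - f x) +
    h^-1 *: (f ((h * c) *: e + (h *: w + x)) - f (h *: w + x)))); last first.
  apply/funext => h; rewrite -[RHS]scalerDr [X in _ = _ *: X]addrC subrKA; congr (_ *: (f _ - _)).
  by rewrite scalerDr scalerA addrA [_ *: e + _]addrC.
apply: cvgD; first by rewrite -Dfw; exact: dfw.
apply/cvgrPdist_le => r r0.
(* The added 1 covers the case c = 0. *)
have c0 : 0 < `|c| + 1 by rewrite ltr_wpDl.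
have rc0 : 0 < r / (`|c| + 1) by rewrite divr_gt0.
move/cvgrPdist_le : ce => /(_ _ rc0)/nbhs_normP[/= d d0 cd].
(* Up to the factor |h|, this bounds the distance from [x] to the intermediate point of the mean
   value theorem. *)
have N0 : 0 < `|w| + `|c| * `|e| + 1.
  by rewrite ltr_wpDl// addr_ge0// mulr_ge0.
near=> h.
have h0 : h != 0 by near: h; exact: nbhs_dnbhs_neq.
have [xi xih ->] := line_mvt (h *: w + x) (h * c) dfe.
rewrite [X in _ - X](_ : _ = c * 'D_e f (xi *: e + (h *: w + x))); last first.
  by rewrite [LHS]mulrA [X in X * _]mulrA mulVf// mul1r.
rewrite -mulrBr normrM.
suff : `|'D_e f x - 'D_e f (xi *: e + (h *: w + x))| <= r / (`|c| + 1).
  rewrite ler_pdivlMr// => /(le_trans _); apply; rewrite mulrC ler_wpM2l//.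
  by rewrite lerDl.
apply: cd => /=; rewrite addrA [X in x - X]addrC opprD addrA subrr add0r normrN.
apply: (@le_lt_trans _ _ (`|h| * (`|w| + `|c| * `|e| + 1))).
  rewrite !mulrDr mulr1 -addrA addrCA; apply: (le_trans (ler_normD _ _)).
  rewrite !normrZ lerD//; last by rewrite lerDl.
  apply: (le_trans (ler_wpM2r (normr_ge0 e) xih)); rewrite normrM.
  by rewrite mulrA.
rewrite -ltr_pdivlMr//; near: h; apply: dnbhs0_lt.
by rewrite divr_gt0.
Unshelve. all: by end_near. Qed.

End directional_derivative.

(** Continuous partial derivatives give derivatives in every direction: the coordinates of [v] are
    added one basis vector at a time. *)
Lemma is_derive_row (R : realType) n (f : 'rV[R]_n -> R) (x v : 'rV[R]_n) :
  (forall j z, derivable f z (delta_mx 0 j)) ->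
  (forall j, continuous (partial j f)) ->
  is_derive x v f (\sum_j v 0 j * partial j f x).
Proof.
move=> df cf; rewrite {1}[v]row_sum_delta.
elim/big_rec2 : _ => [|j dw w _ IH].
  by apply: DeriveDef; [exact: derivable0|exact: derive0].
rewrite addrC [_ + dw]addrC.
by apply: is_derive_add_direction => //; exact: cf.
Qed.

Section test_function.
Context {R : realType} (n : nat).
Implicit Types phi : 'rV[R]_n -> R.

Lemma iter_partial_rcons s j phi :
  iter_partial (rcons s j) phi = iter_partial s (partial j phi).
Proof. by rewrite /iter_partial foldr_rcons. Qed.

Lemma test_function_continuous phi : test_function phi -> continuous phi.
Proof. by case=> /(_ [::])[]. Qed.

Lemma test_function_derivable phi : test_function phi ->
  forall j x, derivable phi x (delta_mx 0 j).
Proof. by case=> /(_ [::])[]. Qed.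

(** Off the closed support of [phi] the function is locally zero, hence so is its derivative; the
    support of the derivative is thus a closed subset of a compact set. *)
Lemma test_function_partial j phi :
  test_function phi -> test_function (partial j phi).
Proof.
move=> [sphi kphi]; split.
  by move=> s; rewrite -iter_partial_rcons; exact: sphi.
apply: subclosed_compact kphi _; first exact: closed_closure.
rewrite [X in X `<=` _]closureE; apply: smallest_sub.
  exact: closed_closure.
move=> x /= Dx; apply: contrapT => xN; move/negP: Dx; apply.
have : \forall y \near x, phi y = cst 0 y.
  have /open_nbhs_nbhs : open_nbhs x (~` closure [set x | phi x != 0]).
    by split => //; exact/closed_openC/closed_closure.
  apply: filterS => y /= yN; apply: contrapT => /eqP phiy.
  exact/yN/subset_closure.
by move=> /near_eq_derive E; rewrite /partial E derive_cst.
Qed.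

(** Stated coordinate by coordinate because it feeds a one-variable integration by parts. The 1
    added to the bound is due to [compact_bounded], which only certifies numbers strictly above its
    constant. *)
Lemma test_function_support phi : test_function phi ->
  exists2 M : R, 0 < M &
    forall (x : 'rV[R]_n) j, M < `|x 0 j| -> phi x = 0.
Proof.
move=> [_ /compact_bounded[M [Mreal kM]]].
exists (`|M| + 1); first by rewrite ltr_wpDl.
move=> x j; apply: contraPP => /eqP phix.
apply/negP; rewrite -leNgt.
have MM : M < `|M| + 1 by rewrite (le_lt_trans (ler_norm _)) ?ltrDl.
apply: le_trans (kM _ MM x (@subset_closure _ [set z | phi z != 0] x phix)).
rewrite /Num.norm/= mx_normrE.
exact: (le_bigmax _ (fun i : 'I_1 * 'I_n => `|x i.1 i.2|) (0, j)).
Qed.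

Lemma test_function_bounded phi : test_function phi ->
  exists2 M : R, 0 < M & forall x, `|phi x| <= M.
Proof.
move=> tphi; have [_ kphi] := tphi.
have : compact (phi @` closure [set x | phi x != 0]).
  apply: continuous_compact => //; apply: continuous_subspaceT.
  exact: test_function_continuous.
move=> /compact_bounded[M [Mreal kM]].
exists (`|M| + 1); first by rewrite ltr_wpDl.
move=> x; have [->|phix] := eqVneq (phi x) 0; first by rewrite normr0 addr_ge0.
apply: kM; first by rewrite (le_lt_trans (ler_norm _)) ?ltrDl.
by exists x => //; exact: subset_closure.
Qed.

Lemma set_coordE (x : 'rV[R]_n) j u :
  set_coord x j u = u *: delta_mx 0 j + set_coord x j 0.
Proof.
apply/rowP => k; rewrite !mxE eqxx/=.
by case: eqP => _; rewrite ?mulr1 ?addr0// mulr0 add0r.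
Qed.

Lemma is_derive_set_coord phi (x : 'rV[R]_n) j (u : R) :
  (forall z, derivable phi z (delta_mx 0 j)) ->
  is_derive u 1 (fun r => phi (set_coord x j r)) (partial j phi (set_coord x j u)).
Proof.
move=> dphi; rewrite set_coordE.
rewrite (_ : (fun r => _) =
    (fun r => phi (r *: delta_mx 0 j + set_coord x j 0))).
  exact: is_derive_line.
by apply/funext => r; rewrite set_coordE.
Qed.

(** Generalized to an arbitrary list and base point for induction: each factor sets its own
    coordinate to 0. *)
Let dirac_fold (phi : 'rV[R]_n -> R) (x : 'rV[R]_n) (s : seq 'I_n) :
  foldr (fun i psi y => dirac1 (fun u => psi (set_coord y i u))) phi s x =
  phi (\row_k if k \in s then 0 else x 0 k).
Proof.
elim: s x => [|i s IHs] x /=; first by congr phi; apply/rowP => k; rewrite mxE.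
rewrite /dirac1 IHs; congr phi; apply/rowP => k; rewrite !mxE inE.
by case: (k == i) => //=; case: ifP.
Qed.

Lemma tensor_dirac phi : tensor_distr (fun=> dirac1) phi = phi 0.
Proof.
rewrite /tensor_distr dirac_fold; congr phi; apply/rowP => k.
by rewrite !mxE mem_enum.
Qed.

(** [uniq s] ensures that [j] is met once only, so exactly two derivatives are taken and the
    remaining factors are evaluations at 0. *)
Let dirac_second_fold (j : 'I_n) phi (x : 'rV[R]_n) (s : seq 'I_n) :
  (forall z, derivable phi z (delta_mx 0 j)) ->
  (forall z, derivable (partial j phi) z (delta_mx 0 j)) ->
  uniq s ->
  foldr (fun i psi y => (if i == j then ddistr1 (ddistr1 dirac1) else dirac1)
     (fun u => psi (set_coord y i u))) phi s x =
  (if j \in s then partial j (partial j phi) else phi)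
    (\row_k if k \in s then 0 else x 0 k).
Proof.
move=> d1 d2; elim: s x => [|i s IHs] x /=.
  by move=> _; congr phi; apply/rowP => k; rewrite mxE.
move=> /andP[iNs us]; rewrite inE eq_sym; case: eqP => [ij|/eqP ij] /=; last first.
  rewrite /dirac1 IHs//; congr ((if _ then _ else _) _); apply/rowP => k.
  by rewrite !mxE inE; case: (k == i) => //=; case: ifP.
subst i; rename iNs into jNs.
pose y : 'rV[R]_n := \row_k if k \in s then 0 else x 0 k.
have yE u : (\row_k if k \in s then 0 else set_coord x j u 0 k) =
    set_coord y j u.
  apply/rowP => k; rewrite !mxE.
  by case: eqP => // ->; rewrite (negbTE jNs).
(* The signs of the two distributional derivatives cancel. *)
rewrite /ddistr1 /dirac1 opprK.
rewrite (_ : (fun u => _) = (fun u => phi (set_coord y j u))); last first.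
  by apply/funext => u; rewrite IHs// (negbTE jNs) yE.
rewrite (_ : (fun u => phi (set_coord y j u))^`()%classic =
    (fun u => partial j phi (set_coord y j u))); last first.
  by apply/funext => u; rewrite derive1E; have /@derive_val-> := is_derive_set_coord y u d1.
rewrite derive1E; have /@derive_val-> := is_derive_set_coord y 0 d2.
congr partial; apply/rowP => k; rewrite !mxE inE.
by case: eqP.
Qed.

Lemma dirac_secondE (j : 'I_n) phi : test_function phi ->
  dirac_second j phi = partial j (partial j phi) 0.
Proof.
move=> tphi; rewrite /dirac_second /tensor_distr dirac_second_fold.
- by rewrite mem_enum; congr partial; apply/rowP => k; rewrite !mxE mem_enum.
- exact: test_function_derivable.
- exact/test_function_derivable/test_function_partial.
- exact: enum_uniq.
Qed.

End test_function.

(** * The law of the subordinated process *)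

Definition mfun_pack d d' (T : measurableType d) (T' : measurableType d')
    (f : T -> T') (mf : measurable_fun setT f) : {mfun T >-> T'} :=
  HB.pack f (isMeasurableFun.Build _ _ _ _ f mf).

Lemma ae_eq_probability (R : realType) d (T : measurableType d)
    (P : probability T R) (X Y : {RV P >-> R}) (U : set R) :
  measurable U -> {ae P, forall w, X w = Y w} ->
  P (X @^-1` U) = P (Y @^-1` U).
Proof.
move=> mU XY.
have mXU (Z : {RV P >-> R}) : measurable (Z @^-1` U).
  by rewrite -[X in measurable X]setTI; exact: measurable_funP.
rewrite -[X @^-1` U]setIT -[Y @^-1` U]setIT -!integral_indic//.
apply: ae_eq_integral => //.
- exact/measurable_EFinP/measurable_indic.
- exact/measurable_EFinP/measurable_indic.
- apply: filterS XY => w XYw _; rewrite !indicE; congr (_%:R%:E).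
  by rewrite /in_mem/= /mem/= /in_set; congr asbool; rewrite /preimage/= XYw.
Qed.

Lemma normal_prob_scale (R : realType) (c : R) (U : set R) :
  0 < c -> measurable U ->
  normal_prob 0 c U = normal_prob 0 1 ((fun x : R => c * x) @^-1` U).
Proof.
move=> c0 mU.
have mcU : measurable ((fun x : R => c * x) @^-1` U).
  by rewrite -[X in measurable X]setTI; exact: mulrl_measurable.
rewrite -[in RHS](setIT (_ @^-1` _)) -integral_indic//.
rewrite [LHS]integral_mkcond epatch_indic.
apply: (ge0_integral_normal_scale (F := EFin \o \1_U) c0) => //.
  exact/measurable_EFinP/measurable_indic.
by move=> x; rewrite /= lee_fin.
Qed.

Section subordination.
Context {R : realType} {d : measure_display} {Omega : measurableType d}.
Context (P : probability Omega R) (n : nat).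
Variables (B : 'I_n -> R -> {RV P >-> R}) (C : R -> {RV P >-> R}).
Hypotheses (hB : forall j, standard_brownian (B j)) (hC : standard_cauchy C).
Hypothesis hBC : independent_processes B C.
Local Open Scope ereal_scope.

(** The hypothesis concerns increments; the increment from time 0 equals [B j s] only almost
    surely. *)
Lemma brownian_marginal j (s : R) (U : set R) : (0 < s)%R -> measurable U ->
  P (B j s @^-1` U) = normal_prob 0 (Num.sqrt s) U.
Proof.
move=> s0 mU; have [B0 _ Bincr _] := hB j.
have := Bincr 0%R s U (lexx 0%R) s0 mU; rewrite subr0 => <-.
pose X : {RV P >-> R} := (B j s \- B j 0)%R.
rewrite -[RHS]/(P (X @^-1` U)); apply: ae_eq_probability => //.
by apply: filterS B0 => w B0w; rewrite /X/= B0w subr0.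
Qed.

Lemma cauchy_marginal (t : R) (U : set R) : (0 < t)%R -> measurable U ->
  P (C t @^-1` U) = \int[lebesgue_measure]_(x in U) (cauchy_pdf t x)%:E.
Proof.
move=> t0 mU; have [C0 _ Cincr _] := hC.
have := Cincr 0%R t U (lexx 0%R) t0 mU; rewrite subr0 => <-.
pose X : {RV P >-> R} := (C t \- C 0)%R.
rewrite -[RHS]/(P (X @^-1` U)); apply: ae_eq_probability => //.
by apply: filterS C0 => w C0w; rewrite /X/= C0w subr0.
Qed.

Lemma process_sigma_marginal (X : R -> {RV P >-> R}) (s : R) (U : set R) :
  (0 <= s)%R -> measurable U -> process_sigma X (X s @^-1` U).
Proof.
move=> s0 mU; apply: sub_sigma_algebra; exists s => /=.
  by rewrite in_itv/= andbT.
by exists U => //; rewrite setTI.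
Qed.

Lemma process_sigmaT (X : R -> {RV P >-> R}) : process_sigma X setT.
Proof. by rewrite -(preimage_setT (X 0%R)); exact: process_sigma_marginal. Qed.

Lemma process_sigma_measurable (X : R -> {RV P >-> R}) :
  process_sigma X `<=` measurable.
Proof.
apply: smallest_sub; first exact: sigma_algebra_measurable.
move=> _ [s _ [U mU <-]]; rewrite setTI.
by rewrite -[X in measurable X]setTI; exact: measurable_funP.
Qed.

(* [Omega] is equipped with the sigma-algebra of the Brownian motions alone:
   there (w, C t w) has a product law, and w, c |-> B |c| w stays measurable. *)
Let brownian_events : set (set Omega) :=
  [set \bigcap_(j in [set: 'I_n]) E j | E in
    [set E : 'I_n -> set Omega | forall j, process_sigma (B j) (E j)]].

Let BOmega := g_sigma_algebraType brownian_events.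

Let brownian_eventsT : brownian_events setT.
Proof.
exists (fun=> setT); first by move=> j; exact: process_sigmaT.
by apply/seteqP; split.
Qed.

Let brownian_eventsI : setI_closed brownian_events.
Proof.
move=> _ _ [E1 hE1 <-] [E2 hE2 <-]; exists (fun j => E1 j `&` E2 j).
  by move=> j; apply: (@measurableI _ (g_sigma_algebraType _)); [exact: hE1|exact: hE2].
by rewrite bigcapI.
Qed.

Let sub_brownian : brownian_events `<=` measurable.
Proof.
move=> _ [E hE <-]; apply: fin_bigcap_measurable => // j _.
exact: (process_sigma_measurable (hE j)).
Qed.

Let sub_BOmega : <<s brownian_events >> `<=` measurable.
Proof.
by apply: smallest_sub => //; exact: sigma_algebra_measurable.
Qed.

(** One event per index of the independence hypothesis, with the slot [None] for the Cauchy
    process. *)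
Let index_events (E : 'I_n -> set Omega) (F : set Omega) (o : option 'I_n) :=
  if o is Some j then E j else F.

Let index_eventsP E F : (forall j, process_sigma (B j) (E j)) ->
  process_sigma C F ->
  forall o, process_sigma (if o is Some j then B j else C) (index_events E F o).
Proof. by move=> hE hF [j|] /=; [exact: hE|exact: hF]. Qed.

(** Independence is applied to the Brownian indices alone, so that the same product reappears when
    [None] is factored out of the full one. *)
Let brownian_eventE (E : 'I_n -> set Omega) :
  (forall j, process_sigma (B j) (E j)) ->
  P (\bigcap_(j in [set: 'I_n]) E j) =
  \prod_(o in [set~ None]%SET) P (index_events E setT o).
Proof.
move=> hE; rewrite -(hBC (A := index_events E setT)) => [|o _]; last first.
  by apply: index_eventsP => //; exact: process_sigmaT.
congr (P _); apply/seteqP; split => w /= Ew.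
  by move=> [j|]; rewrite /= !inE//= => _; exact: Ew.
by move=> j _; apply: (Ew (Some j)); rewrite /= !inE.
Qed.

Let brownian_cauchy_indep (E : 'I_n -> set Omega) F :
  (forall j, process_sigma (B j) (E j)) -> process_sigma C F ->
  P ((\bigcap_(j in [set: 'I_n]) E j) `&` F) =
  P (\bigcap_(j in [set: 'I_n]) E j) * P F.
Proof.
move=> hE hF; rewrite brownian_eventE//.
transitivity (P (\bigcap_(o in [set` [set: option 'I_n]%SET]) index_events E F o)).
  congr (P _); apply/seteqP; split => w /=.
    by move=> [Ew Fw] [j|] _ //=; exact: Ew.
  by move=> EFw; split; [move=> j _; apply: (EFw (Some j))|apply: (EFw None)];
    rewrite /= !inE.
rewrite (hBC (A := index_events E F)) => [|o _]; last exact: index_eventsP.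
rewrite (bigD1 None) ?inE//= muleC; congr (_ * _).
by apply: eq_big; case=> [j|]; rewrite !inE.
Qed.

Lemma brownian_box (s : R) (A : 'I_n -> set R) : (0 < s)%R ->
  (forall j, measurable (A j)) ->
  P [set w | box A [tuple B j s w | j < n]] =
  \prod_(j < n) normal_prob 0 (Num.sqrt s) (A j).
Proof.
move=> s0 mA.
rewrite (_ : [set w | _] = \bigcap_(j in [set: 'I_n]) (B j s @^-1` A j)).
  rewrite brownian_eventE; last first.
    by move=> j; apply: process_sigma_marginal => //; exact: ltW.
  rewrite (_ : [set~ None]%SET = (@Some 'I_n) @: [set: 'I_n]%SET); last first.
    apply/setP => -[j|]; rewrite !inE/=; apply/esym.
      by rewrite imset_f// inE.
    by apply/negbTE/imsetP => -[].
  rewrite big_imset/=; last by move=> i j _ _ [].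
  apply: eq_big => [j|j _]; first by rewrite inE.
  by rewrite brownian_marginal.
apply/seteqP; split => w /=; first by move=> Aw j _; have := Aw j; rewrite tnth_mktuple.
by move=> Aw j; rewrite tnth_mktuple; exact: Aw.
Qed.

(** On boxes both sides are products of one-dimensional normal laws, and boxes determine the law. *)
Lemma brownian_tuple_law (s : R) (A : set (n.-tuple R)) : (0 < s)%R ->
  measurable A ->
  P [set w | A [tuple B j s w | j < n]] =
  gauss_tuple R n (tuple_scale (Num.sqrt s) @^-1` A).
Proof.
move=> s0 mA.
have mX : measurable_fun setT (fun w => [tuple B j s w | j < n]).
  apply/measurable_fun_tnthP => j; rewrite (_ : _ \o _ = B j s)//.
  by apply/funext => w /=; rewrite tnth_mktuple.
apply: (@tuple_measure_unique R n (distribution P (mfun_pack mX))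
  (distribution (gauss_tuple R n)
    (mfun_pack (@measurable_tuple_scale R n (Num.sqrt s))))) => // {mA}A mA.
rewrite [LHS](brownian_box s0 mA) /distribution /pushforward/=.
have ss0 : (0 < Num.sqrt s)%R by rewrite sqrtr_gt0.
transitivity (gauss_tuple R n
    (box (fun j => (fun x : R => Num.sqrt s * x)%R @^-1` A j))).
  have mAs j : measurable ((fun x : R => Num.sqrt s * x)%R @^-1` A j).
    by rewrite -[X in measurable X]setTI; exact: mulrl_measurable.
  rewrite gauss_tuple_box//; apply: eq_bigr => j _.
  exact: normal_prob_scale.
congr (_ _); apply/seteqP; split => x /= xA j; have := xA j;
  by rewrite tnth_mktuple.
Qed.

(** * Random time change and the mixture formula *)

Let mBid : measurable_fun setT (fun w : Omega => w : BOmega).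
Proof. by move=> _ E mE; rewrite setTI; exact: sub_BOmega. Qed.

Let PB := distribution P (mfun_pack mBid).

(** For fixed [F], the finite measures E -> P(E and F) and E -> P(E) P(F) agree on a generating
    class stable under intersection, hence on the whole Brownian sigma-algebra. *)
Let brownian_cauchy_indep_sigma (E : set BOmega) (F : set Omega) :
  measurable E -> process_sigma C F -> P (E `&` F) = P E * P F.
Proof.
move=> mE hF.
have mF : measurable F by exact: process_sigma_measurable hF.
have pF0 : (0 <= fine (P F))%R by rewrite fine_ge0.
pose m1 : {measure set BOmega -> \bar R} :=
  pushforward (mrestr P mF) (mfun_pack mBid).
pose m2 : {measure set BOmega -> \bar R} := mscale (NngNum pF0) PB.
have m1E D : m1 mBid D = P (D `&` F) by [].
have m2E D : m2 D = P D * P F.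
  by rewrite /m2/= /mscale/= fineK ?fin_num_measure// muleC.
rewrite -m1E -m2E.
apply: (@measure_unique _ R BOmega brownian_events (fun=> setT) _ _ _ _
  (m1 mBid) m2) => //.
- by rewrite bigcup_const.
- by move=> _ [D hD <-]; rewrite m1E m2E; exact: brownian_cauchy_indep.
- by move=> k; rewrite m1E (le_lt_trans (probability_le1 _ _)) ?ltry// setTI.
Qed.

Let flow (p : BOmega * measurableTypeR R) : n.-tuple R :=
  [tuple B j `|p.2| p.1 | j < n].

(** The Carathéodory criterion: each path is continuous in time, and at a fixed time B_j is
    measurable for the Brownian sigma-algebra. *)
Let measurable_flow : measurable_fun setT flow.
Proof.
apply/measurable_fun_tnthP => j.
rewrite (_ : _ \o _ = (fun p : measurableTypeR R * BOmega => B j `|p.1| p.2)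
    \o (fun p => (p.2, p.1))); last first.
  by apply/funext => p; rewrite /= tnth_mktuple.
apply: measurableT_comp; last exact: measurable_fun_pair.
apply: (@measurable_fun_caratheodory R _ BOmega (fun a w => B j `|a| w)).
  move=> w a; have [_ _ _ /(_ w)/subspace_continuousP cB] := hB j.
  (* Paths are continuous within [0, +oo[ only; since |b| stays in that set, composing with the
     absolute value gives continuity on the whole line. *)
  have a0 : `[0%R, +oo[%classic `|a|%R by rewrite /= in_itv/= andbT.
  move=> U /(cB _ a0) nU.
  have : nbhs a (fun b => `[0%R, +oo[%classic `|b|%R -> U (B j `|b|%R w)).
    exact: (@norm_continuous _ _ a _ nU).
  by apply: filterS => b; apply; rewrite /= in_itv/= andbT.
move=> a _ U mU; rewrite setTI; apply: sub_sigma_algebra.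
(* A Brownian event in which only the [j]-th motion is constrained. *)
exists (fun i => if i == j then B j `|a|%R @^-1` U else setT) => [i|].
  case: eqP => [->|_]; last exact: process_sigmaT.
  exact: process_sigma_marginal.
apply/seteqP; split => w /=; first by move/(_ j Logic.I); rewrite eqxx.
by move=> UB i _; case: ifP.
Qed.

Variable t : R.
Hypothesis t0 : (0 < t)%R.

Let mpair : measurable_fun setT
  (fun w : Omega => (w, C t w) : BOmega * measurableTypeR R).
Proof.
apply: measurable_fun_pair; first exact: mBid.
exact: (measurable_funP (C t)).
Qed.

Lemma measurable_J_BC : measurable_fun setT (J_BC B C t).
Proof. exact: (measurableT_comp measurable_flow mpair). Qed.

Let mC : measurable_fun setT (C t : Omega -> measurableTypeR R).
Proof. exact: (measurable_funP (C t)). Qed.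

Let cauchy_law := distribution P (mfun_pack mC).

(** By independence, the law of (w, C t w) and the product measure agree on rectangles. *)
Let joint_law (D : set (BOmega * measurableTypeR R)) : measurable D ->
  (PB \x cauchy_law) D = P [set w | D (w, C t w)].
Proof.
move=> mD; apply: (@product_measure_unique _ _ _ _ _ PB cauchy_law
  (distribution P (mfun_pack mpair))) => //.
move=> E F mE mF; rewrite -[RHS]brownian_cauchy_indep_sigma//.
exact: process_sigma_marginal (ltW t0) mF.
Qed.

(** The conditional probability that the subordinated vector lies in [A], given C(t) = c. *)
Let hit (A : set (n.-tuple R)) (c : R) : \bar R :=
  \int[PB]_w (\1_(flow @^-1` A) (w, c))%:E.

Let measurable_hit A : measurable A -> measurable_fun setT (hit A).
Proof.
move=> mA; apply: (@measurable_fun_fubini_tonelli_G _ _ _ _ _ PB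
  (EFin \o \1_(flow @^-1` A))).
  apply/measurable_EFinP/measurable_indic.
  by rewrite -[X in measurable X]setTI; exact: measurable_flow.
by move=> p; rewrite lee_fin.
Qed.

Let hit_ge0 A c : 0 <= hit A c.
Proof. by apply: integral_ge0 => w _; rewrite lee_fin. Qed.

(** The value c = 0 is excluded because the Gaussian law of B(s) is available for s > 0 only. *)
Let hitE A c : c != 0%R -> measurable A ->
  hit A c = gauss_tuple R n (tuple_scale (Num.sqrt `|c|) @^-1` A).
Proof.
move=> c0 mA; rewrite -brownian_tuple_law ?normr_gt0//.
have mAc : measurable ((fun w => (w, c)) @^-1` (flow @^-1` A)).
  rewrite -[X in measurable X]setTI; apply: (pair2_measurable c) => //.
  by rewrite -[X in measurable X]setTI; exact: measurable_flow.
transitivity (\int[PB]_w (\1_((fun w => (w, c)) @^-1` (flow @^-1` A)) w)%:E).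
  by apply: eq_integral.
by rewrite integral_indic// setIT.
Qed.

Let J_BC_mixture (A : set (n.-tuple R)) : measurable A ->
  P (J_BC B C t @^-1` A) = \int[cauchy_law]_c hit A c.
Proof.
move=> mA; have mflA : measurable (flow @^-1` A).
  by rewrite -[X in measurable X]setTI; exact: measurable_flow.
transitivity (\int[PB \x cauchy_law]_p (\1_(flow @^-1` A) p)%:E).
  by rewrite integral_indic// setIT; apply/esym/joint_law.
rewrite (@fubini_tonelli2 _ _ _ _ _ PB cauchy_law
  (EFin \o \1_(flow @^-1` A)))//.
- exact/measurable_EFinP/measurable_indic.
- by move=> p; rewrite lee_fin.
Qed.

Let cauchy_pdf_ge0 c : (0 <= cauchy_pdf t c)%R.
Proof.
by rewrite /cauchy_pdf divr_ge0 ?(ltW t0)// mulr_ge0 ?pi_ge0// addr_ge0 ?sqr_ge0.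
Qed.

Let measurable_cauchy_pdf : measurable_fun setT (cauchy_pdf t).
Proof.
apply: measurable_funM => //; apply: (measurableT_comp (@measurable_invr R)).
by apply: measurable_funM => //; exact: measurable_funD.
Qed.

(** The mixture over the Cauchy law is folded at 0: [hit A c] depends on |c| and the Cauchy density
    is even, so the two half-lines contribute equally. *)
Lemma joint_density_J_BC : joint_density P (J_BC B C t) (@p_BC R n t).
Proof.
split.
- exact: measurable_J_BC.
- exact: measurable_p_BC.
- by move=> x; exact: p_BC_ge0.
move=> A mA; rewrite J_BC_mixture//.
have mF : measurable_fun setT (fun c => (cauchy_pdf t c)%:E * hit A c).
  apply: emeasurable_funM; first exact/measurable_EFinP.
  exact: measurable_hit.
have F0 c : 0 <= (cauchy_pdf t c)%:E * hit A c by rewrite mule_ge0// lee_fin.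
rewrite (@ge0_integral_density _ _ R lebesgue_measure cauchy_law
  (cauchy_pdf t))//; last 2 first.
- by move=> U mU; rewrite -cauchy_marginal.
- exact: measurable_hit.
rewrite [RHS]integral_mkcond epatch_indic.
rewrite [RHS](ge0_integral_p_BC t0 (psi := EFin \o \1_A)); last 2 first.
- exact/measurable_EFinP/measurable_indic.
- by move=> x; rewrite lee_fin.
rewrite (_ : [set: _] = `]-oo, 0%R] `|` `]0%R, +oo[)%classic; last first.
  by rewrite -itv_bndbnd_setU ?set_itvNyy.
rewrite ge0_integral_setU//=; last 2 first.
- exact: measurable_funTS.
- apply/disj_setPS => c /=; rewrite !in_itv/= andbT => -[c0 c1].
  by have := lt_le_trans c1 c0; rewrite ltxx.
rewrite -[X in X + _]/(\int[lebesgue_measure]_(c in `]-oo, 0%R])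
  (fun c => (cauchy_pdf t c)%:E * hit A c) c).
(* The reflection c -> -c carries the negative half-line to the positive one. *)
have := @ge0_integration_by_substitution0 R
  ((fun c => (cauchy_pdf t c)%:E * hit A c) \o -%R).
have mFN : measurable_fun setT ((fun c => (cauchy_pdf t c)%:E * hit A c) \o -%R).
  exact: measurableT_comp.
move=> /(_ mFN (fun c => F0 _)) /=.
under [X in _ = X -> _]eq_integral do rewrite opprK.
move=> <-.
(* The endpoint 0, where [hitE] says nothing, is a null set. *)
rewrite -integral_itv_obnd_cbnd; last exact: measurable_funTS.
rewrite -ge0_integralD//; [|exact: measurable_funTS..].
rewrite (_ : [set s : R | (0 < s)%R] = `]0%R, +oo[%classic); last first.
  by apply/seteqP; split => s /=; rewrite in_itv/= andbT.
apply: eq_integral => s; rewrite inE/= in_itv/= andbT => s0.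
rewrite !hitE ?oppr_eq0 ?gt_eqF// normrN gtr0_norm//.
have mAs : measurable (tuple_scale (Num.sqrt s) @^-1` A).
  by rewrite -[X in measurable X]setTI; exact: measurable_tuple_scale.
rewrite (_ : \int[gauss_tuple R n]_z _ =
    gauss_tuple R n (tuple_scale (Num.sqrt s) @^-1` A)); last first.
  transitivity (\int[gauss_tuple R n]_z
      (\1_(tuple_scale (Num.sqrt s) @^-1` A) z)%:E); first exact: eq_integral.
  by rewrite integral_indic// setIT.
(* The two equal halves add up to 2/pi times t / (t^2 + s^2). *)
rewrite -ge0_muleDl ?lee_fin// -EFinD; congr (_%:E * _).
rewrite /cauchy_pdf sqrrN; move: (@pi R) (pi_gt0 R) => p p0; field.
by rewrite !gt_eqF// addr_gt0// exprn_gt0.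
Qed.

End subordination.

(** * Heat semigroup and Poisson kernel *)

Section one_variable.
Context {R : realType}.
Local Notation mu := (@lebesgue_measure R).
Local Notation N := (@normal_prob R 0 1).

Lemma is_derive_normal_pdf (x : R) :
  is_derive x 1 (normal_pdf 0 1 : R -> R) (- x * normal_pdf 0 1 x).
Proof.
have E : normal_pdf 0 1 = (fun y : R => normal_peak 1 * expR (- 2^-1 * y ^+ 2)).
  rewrite normal_pdfE ?oner_eq0//; apply/funext => y.
  by rewrite /normal_fun subr0 expr1n; congr (_ * expR _); field.
have dq : is_derive x 1 (fun y : R => - 2^-1 * y ^+ 2) (- x).
  have /is_derive_eq := is_deriveZ (- 2^-1) (is_deriveX 2 (is_derive_id x (1 : R))).
  by apply; rewrite /GRing.scale/= expr1; field.
have /is_derive_eq := is_deriveZ (normal_peak (1 : R))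
  (is_derive1_comp (is_derive_expR _) dq).
by rewrite E; apply; rewrite /GRing.scale/=; ring.
Qed.

(** |x| times the standard normal density is at most sqrt(2) times the normal density of variance 2,
    whose mass is 1. *)
Lemma integrable_abs_normal : N.-integrable setT (fun u : R => `|u|%:E).
Proof.
apply/integrableP; split; first by apply/measurable_EFinP; exact: normr_measurable.
have s2 : Num.sqrt 2 != 0 :> R by rewrite gt_eqF// sqrtr_gt0.
rewrite (@ge0_integral_density _ _ R mu N (normal_pdf 0 1))//; last 3 first.
- exact: measurable_normal_pdf.
- exact: normal_pdf_ge0.
- by apply/measurable_EFinP; apply: measurableT_comp => //; exact: normr_measurable.
apply: (@le_lt_trans _ _ (\int[mu]_x ((Num.sqrt 2)%:E * (EFin \o normal_pdf 0 (Num.sqrt 2)) x)%E)%E).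
  apply: ge0_le_integral => //.
  - by move=> x _; rewrite mule_ge0// lee_fin normal_pdf_ge0.
  - apply: emeasurable_funM; first by apply/measurable_EFinP; exact: measurable_normal_pdf.
    by apply/measurable_EFinP; apply: measurableT_comp => //; exact: normr_measurable.
  - apply: emeasurable_funM => //; apply/measurable_EFinP.
    exact: measurable_normal_pdf.
  move=> x _; rewrite /= -!EFinM lee_fin normr_id.
  rewrite !normal_pdfE ?oner_eq0// /normal_peak /normal_fun subr0 expr1n mul1r.
  rewrite sqr_sqrtr//.
  rewrite [X in _ <= _ * (X^-1 * _)](_ : _ = Num.sqrt 2 * Num.sqrt (pi *+ 2)); last first.
    by rewrite -sqrtrM// -mulrnAr.
  rewrite invfM !mulrA divff// mul1r -mulrA ler_wpM2l ?invr_ge0//.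
  rewrite [X in expR X](_ : _ = (- (x ^+ 2 / 4)) + (- (x ^+ 2 / 4))); last by field.
  rewrite [X in _ <= expR X](_ : _ = - (x ^+ 2 / 4)); last by field.
  (* |x| <= 1 + x^2 / 4 <= exp (x^2 / 4) *)
  rewrite expRD -mulrA ler_piMr ?expR_ge0// expRN mulrC ler_pdivrMr ?expR_gt0// mul1r.
  apply: le_trans (expR_ge1Dx _).
  rewrite -subr_ge0 (_ : _ - _ = (1 - `|x| / 2) ^+ 2) ?sqr_ge0//.
  by rewrite -[x ^+ 2]real_normK ?num_real//; field.
rewrite ge0_integralZl//; last 2 first.
- by apply/measurable_EFinP; exact: measurable_normal_pdf.
- by move=> x _; rewrite lee_fin normal_pdf_ge0.
by rewrite integral_normal_pdf mule1 ltry.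
Qed.

Lemma Rintegral_normal_support (h : R -> R) (M : R) :
  measurable_fun setT h -> (forall x, M < `|x| -> h x = 0) ->
  \int[N]_u h u = \int[mu]_(u in `[- M, M]) (normal_pdf 0 1 u * h u).
Proof.
move=> mh h0; rewrite [RHS]Rintegral_mkcond /Rintegral; congr fine.
rewrite (@integral_density _ _ R mu N (normal_pdf 0 1))//; last 3 first.
- exact: measurable_normal_pdf.
- exact: normal_pdf_ge0.
- exact/measurable_EFinP.
apply: eq_integral => x _; rewrite -EFinM; congr EFin.
rewrite patchE; case: ifPn => //; rewrite notin_setE/= in_itv/= => xM.
by rewrite h0 ?mulr0// ltNge ler_norml; apply/negP.
Qed.

(** Stein's identity E[Z f(Z)] = E[f'(Z)], by parts on a segment outside which [f] vanishes. *)
Lemma stein (f f' : R -> R) (M : R) : 0 < M ->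
  (forall x : R, is_derive x 1 f (f' x)) -> continuous f' ->
  (forall x, M < `|x| -> f x = 0) ->
  \int[N]_u (u * f u) = \int[N]_u f' u.
Proof.
move=> M0 df cf' f0.
have cf : continuous f.
  move=> x; apply/differentiable_continuous/derivable1_diffP; exact: ex_derive.
have f'0 x : M < `|x| -> f' x = 0.
  move=> xM; have <- : 'D_1 f x = f' x by exact: derive_val.
  rewrite (@near_eq_derive _ _ _ _ (cst 0)) ?derive_cst//.
  by near=> y; apply: f0; near: y; exact: (cvgr_norm_gt x).
(* [f] is known to vanish only where |x| > M strictly; the segment is enlarged so that it vanishes
   at both endpoints. *)
have M1 : M < M + 1 by rewrite ltrDl.
have N1 : - (M + 1) < M + 1 by lra.
rewrite (@Rintegral_normal_support _ (M + 1)); last 2 first.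
- by apply: measurable_funM => //; exact: continuous_measurable_fun.
- by move=> x xM; rewrite f0 ?mulr0// (lt_trans M1).
rewrite (@Rintegral_normal_support _ (M + 1)); last 2 first.
- exact: continuous_measurable_fun.
- by move=> x xM; rewrite f'0// (lt_trans M1).
(* A primitive of x times the normal density. *)
pose G (x : R) := - normal_pdf 0 1 x.
have cN : continuous (normal_pdf 0 1 : R -> R).
  by apply: continuous_normal_pdf; rewrite oner_eq0.
have dG (x : R) : is_derive x 1 G (x * normal_pdf 0 1 x).
  have := is_deriveN (is_derive_normal_pdf x); rewrite mulNr opprK; exact.
transitivity (\int[mu]_(x in `[- (M + 1), M + 1]) (f x * (x * normal_pdf 0 1 x))).
  by apply: eq_Rintegral => x _; ring.
rewrite (@Rintegration_by_parts _ f G f' (fun x => x * normal_pdf 0 1 x))//.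
- rewrite !f0; last 2 first.
  + by rewrite normrN gtr0_norm// (lt_trans M0).
  + by rewrite gtr0_norm// (lt_trans M0).
  rewrite !(mul0r, subrr, sub0r, oppr0).
  have iN : mu.-integrable `[(- (M + 1)), M + 1]
      (EFin \o (fun x => normal_pdf 0 1 x * f' x)).
    apply: continuous_compact_integrable; first exact: segment_compact.
    by apply: continuous_subspaceT => x; apply: cvgM; [exact: cN|exact: cf'].
  rewrite -[RHS]opprK; congr (- _).
  rewrite -[RHS]mulN1r -RintegralZl//; apply: eq_Rintegral => x _.
  by rewrite /G; ring.
- by apply: continuous_subspaceT.
- split; [by move=> x _; exact: ex_derive|..].
  + exact/cvg_at_right_filter/cf.
  + exact/cvg_at_left_filter/cf.
- by move=> x _; rewrite derive1E derive_val.
- by apply: continuous_subspaceT => x; apply: cvgM; [exact: cvg_id|exact: cN].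
- split; [by move=> x _; exact: ex_derive|..].
  + by apply: cvg_at_right_filter; apply: cvgN; exact: cN.
  + by apply: cvg_at_left_filter; apply: cvgN; exact: cN.
- by move=> x _; rewrite derive1E derive_val.
Unshelve. all: by end_near. Qed.

Local Notation kappa := (fun s : R => (oneDsqr s)^-1).

Lemma integrable_oneDsqrV : mu.-integrable `[0, +oo[ (EFin \o kappa).
Proof.
apply/integrableP; split.
  have mk : measurable_fun setT kappa.
    by apply: continuous_measurable_fun; exact: continuous_oneDsqrV.
  exact/measurable_EFinP/measurable_funTS.
have -> : (\int[mu]_(s in `[0%R, +oo[) `|(EFin \o kappa) s| = (pi / 2)%:E)%E.
  rewrite -integral0y_oneDsqr; apply: eq_integral => s _.
  by rewrite /= ger0_norm// invr_ge0 (le_trans ler01)// oneDsqr_ge1.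
by rewrite ltry.
Qed.

Lemma integrable_le_oneDsqrV (w : R -> R) (M : R) :
  measurable_fun `[(0:R), +oo[ w ->
  (forall s, 0 <= s -> `|w s| <= M * kappa s) ->
  mu.-integrable `[0, +oo[ (EFin \o w).
Proof.
move=> mw wM; apply: (@le_integrable _ _ _ mu _ _ _
    (fun s => M%:E * (EFin \o kappa) s)%E) => //.
- exact/measurable_EFinP.
- move=> s /=; rewrite in_itv/= andbT => s0.
  by rewrite lee_fin (le_trans (wM _ s0))// ler_norm.
- by apply: integrableZl => //; exact: integrable_oneDsqrV.
Qed.

Lemma Rintegral_FTC2y (W w : R -> R) (M l : R) :
  (forall s, 0 <= s -> `|w s| <= M * kappa s) ->
  {within `[0, +oo[, continuous w} ->
  W x @[x --> +oo] --> l -> (forall s : R, 0 < s -> is_derive s 1 W (w s)) ->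
  W x @[x --> 0^'+] --> W 0 ->
  \int[mu]_(s in `[0, +oo[) w s = l - W 0.
Proof.
move=> wM cw Wl dW W0.
have mw : measurable_fun `[(0:R), +oo[ w.
  apply: subspace_continuous_measurable_fun => //.
have iw := integrable_le_oneDsqrV mw wM.
have iM : mu.-integrable `[0, +oo[ (EFin \o (fun s => M * kappa s)).
  have mI : measurable (`[0%R, +oo[%classic : set (measurableTypeR R)) by [].
  exact: (integrableZl mI M integrable_oneDsqrV).
have cMk : continuous (fun s : R => M * kappa s).
  by move=> s; apply: cvgM; [exact: cvg_cst|exact: continuous_oneDsqrV].
have dMatan (s : R) : is_derive s 1 (fun s : R => M * atan s) (M * kappa s).
  exact: (is_deriveZ M (is_derive1_atan s)).
(* The library version needs a nonnegative integrand: add M / (1 + s^2), whose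
   primitive is M atan. *)
have := @Rintegral_ge0_continuous_FTC2y R (fun s => w s + M * kappa s)
  (fun s => W s + M * atan s) 0 (l + M * (pi / 2)).
rewrite RintegralD// RintegralZl//; last exact: integrable_oneDsqrV.
rewrite {2}/Rintegral integral0y_oneDsqr/= atan0 mulr0 addr0 => H.
apply: (@addIr _ (M * (pi / 2))); rewrite H.
- by rewrite addrAC.
- move=> s s0; have := wM _ s0; rewrite ler_norml => /andP[+ _].
  by rewrite -subr_ge0 opprK.
- by apply: within_continuousD => //; exact: continuous_subspaceT.
- by apply: cvgD => //; apply: cvgM; [exact: cvg_cst|exact: cvgy_atan].
- by move=> s s0; have := dW s s0 => ?; exact: ex_derive.
- have Matan0 : M * atan x @[x --> 0^'+] --> M * atan 0.
    apply: cvg_at_right_filter; apply: cvgM; first exact: cvg_cst.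
    exact: continuous_atan.
  by rewrite atan0 mulr0 in Matan0; rewrite -[X in _ --> X]addr0; exact: cvgD.
- move=> s; rewrite in_itv/= andbT => s0; rewrite derive1E.
  by have := dW s s0 => ?; rewrite derive_val.
Qed.

End one_variable.

Lemma Rintegral_sum d (T : measurableType d) (R : realType)
    (mu : {measure set T -> \bar R}) (D : set T) (I : Type) (s : seq I)
    (f : I -> T -> R) : measurable D ->
  (forall i, mu.-integrable D (EFin \o f i)) ->
  \int[mu]_(x in D) (\sum_(i <- s) f i x) =
  \sum_(i <- s) \int[mu]_(x in D) f i x.
Proof.
move=> mD intf; elim: s => [|i s IHs].
  under eq_Rintegral do rewrite big_nil.
  by rewrite big_nil /Rintegral integral0.
have iS : mu.-integrable D (EFin \o (fun x => \sum_(i <- s) f i x)).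
  rewrite (_ : _ \o _ = (fun x => \sum_(i <- s) (EFin \o f i) x)%E).
    exact: integrable_sum.
  by apply/funext => x; rewrite /= sumEFin.
rewrite big_cons -IHs -RintegralD//.
by apply: eq_Rintegral => x _; rewrite big_cons.
Qed.

Definition row_of_tuple (R : realType) n (x : n.-tuple R) : 'rV[R]_n :=
  \row_j tnth x j.

(** * Gaussian means as functions of the standard deviation *)

Section gauss_mean.
Context {R : realType} (n : nat).
Implicit Types phi : 'rV[R]_n -> R.
Local Notation N := (@normal_prob R 0 1).
Local Notation gamma := (gauss_tuple R n).

Lemma row_of_tuple_scale (c : R) (x : n.-tuple R) :
  row_of_tuple (tuple_scale c x) = c *: row_of_tuple x.
Proof. by apply/rowP => j; rewrite !mxE tnth_mktuple. Qed.

Lemma row_of_tuple_set (x : n.-tuple R) j u :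
  row_of_tuple (tuple_set x j u) = set_coord (row_of_tuple x) j u.
Proof. by apply/rowP => k; rewrite !mxE tnth_tuple_set. Qed.

Lemma scale_set_coord (c : R) (x : 'rV[R]_n) j u :
  c *: set_coord x j u = set_coord (c *: x) j (c * u).
Proof. by apply/rowP => k; rewrite !mxE; case: eqP. Qed.

Lemma continuous_set_coord (x : 'rV[R]_n) j : continuous (set_coord x j).
Proof.
move=> u; rewrite (_ : set_coord x j =
    (fun u => u *: delta_mx 0 j + set_coord x j 0)); last first.
  by apply/funext => v; exact: set_coordE.
by apply: cvgD; [apply: cvgZr_tmp|exact: cvg_cst].
Qed.

Lemma measurable_continuous_row phi : continuous phi ->
  measurable_fun setT (fun x : n.-tuple R => phi (row_of_tuple x)).
Proof.
move=> cphi; apply: measurable_separately_continuous => x j u.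
rewrite (_ : (fun u => _) = phi \o set_coord (row_of_tuple x) j); last first.
  by apply/funext => v; rewrite row_of_tuple_set.
by apply: continuous_comp; [exact: continuous_set_coord|exact: cphi].
Qed.

Lemma measurable_continuous_row_scale phi (c : R) : continuous phi ->
  measurable_fun setT (fun x : n.-tuple R => phi (c *: row_of_tuple x)).
Proof.
move=> cphi; rewrite (_ : (fun x => _) =
    (fun x => phi (row_of_tuple x)) \o tuple_scale c); last first.
  by apply/funext => x; rewrite /= row_of_tuple_scale.
apply: measurableT_comp; first exact: measurable_continuous_row.
exact: measurable_tuple_scale.
Qed.

Lemma bounded_integrable_gauss (f : n.-tuple R -> R) (M : R) :
  measurable_fun setT f -> (forall z, `|f z| <= M) ->
  gamma.-integrable setT (EFin \o f).
Proof.
move=> mf fM; apply: measurable_bounded_integrable => //.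
  by rewrite (le_lt_trans (probability_le1 gamma measurableT)) ?ltry.
exists M; split; first exact: num_real.
by move=> y My z _; exact: le_trans (fM z) (ltW My).
Qed.

(** The parameter is the standard deviation and not the time: the integrand is as smooth in [c] as
    [phi] is, even at 0. The square root enters only in [heat]. *)
Definition gauss_mean phi (c : R) : R :=
  \int[gamma]_z phi (c *: row_of_tuple z).

Section bounded_continuous.
Variables (phi : 'rV[R]_n -> R) (M : R).
Hypotheses (cphi : continuous phi) (phiM : forall x, `|phi x| <= M).

Lemma integrable_gauss_mean (c : R) :
  gamma.-integrable setT (EFin \o (fun z => phi (c *: row_of_tuple z))).
Proof.
apply: (@bounded_integrable_gauss _ M) => //.
exact: measurable_continuous_row_scale.
Qed.

Lemma gauss_mean_bounded (c : R) : `|gauss_mean phi c| <= M.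
Proof.
apply: le_trans (le_normr_Rintegral _ (integrable_gauss_mean c)) _ => //.
rewrite -[leRHS]mulr1 -[X in _ * X]/(fine 1%E) -(@probability_setT _ _ _ gamma).
rewrite -Rintegral_cst//; apply: le_Rintegral => //.
- have := integrable_gauss_mean c.
  by move/integrable_abse.
- apply: (@bounded_integrable_gauss _ M) => // z.
  by rewrite ger0_norm// (le_trans _ (phiM 0)).
Qed.

Lemma continuous_gauss_mean : continuous (gauss_mean phi).
Proof.
move=> c; have M0 : 0 <= M by rewrite (le_trans _ (phiM 0)).
apply: (@continuity_under_integral R _ _ gamma
  (fun c z => phi (c *: row_of_tuple z)) setT measurableT (c - 1) (c + 1)
  _ _ (cst M)) => //.
- by move=> y _; exact: integrable_gauss_mean.
- apply: aeW => z _ y _ /=; apply: continuous_comp.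
    exact: scalel_continuous.
  exact: cphi.
- apply: (@bounded_integrable_gauss _ M) => // z.
  by rewrite /= ger0_norm.
- by move=> y _; apply: aeW => z _; exact: phiM.
- by rewrite inE/= in_itv/= ltrBlDr ltrDl ltr01.
Qed.

End bounded_continuous.

Lemma gauss_mean0 phi : gauss_mean phi 0 = phi 0.
Proof.
rewrite /gauss_mean; under eq_Rintegral do rewrite scale0r.
by rewrite Rintegral_cst// [X in fine X](@probability_setT _ _ _ gamma) mulr1.
Qed.

Lemma integrable_gauss_test phi (c : R) : test_function phi ->
  gamma.-integrable setT (EFin \o (fun z => phi (c *: row_of_tuple z))).
Proof.
move=> tphi; have [M _ phiM] := test_function_bounded tphi.
exact: integrable_gauss_mean (test_function_continuous tphi) phiM c.
Qed.

Lemma gauss_tuple_marginal (j : 'I_n) (U : set R) : measurable U ->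
  gamma ((@tnth n R)^~ j @^-1` U) = N U.
Proof.
move=> mU.
transitivity (gamma (box (fun i => if i == j then U else setT))).
  congr (_ _); apply/seteqP; split => x /= Ux.
    by move=> i; case: eqP => // ->.
  by have := Ux j; rewrite eqxx.
rewrite gauss_tuple_box; last by move=> i; case: eqP.
rewrite (bigD1 j)//= eqxx big1 ?mule1// => i /negbTE ->.
by rewrite probability_setT.
Qed.

Lemma integrable_abs_coord (j : 'I_n) :
  gamma.-integrable setT (fun z => `|tnth z j|%:E).
Proof.
have mj : measurable_fun setT (fun z : n.-tuple R => `|tnth z j|%:E).
  apply/measurable_EFinP; apply: measurableT_comp; first exact: normr_measurable.
  exact: measurable_tnth.
apply/integrableP; split => //.
have /integrableP[ma] := @integrable_abs_normal R; apply: le_lt_trans.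
have mt : measurable_fun setT (fun z : n.-tuple R => tnth z j : measurableTypeR R).
  exact: measurable_tnth.
rewrite -(@ge0_integral_pushforward _ _ _ _ _ _ mt gamma setT
  (fun u : R => `| `|u|%:E |%E))//.
rewrite [leLHS](eq_measure_integral N) => [|A mA _].
  exact: lexx.
  exact: gauss_tuple_marginal.
exact: measurableT_comp.
Qed.

(** Coordinate [j] is resampled and Stein's identity is applied to it with the others frozen; the
    chain rule produces the factor [c]. *)
Lemma gauss_integration_by_parts phi (c : R) (j : 'I_n) :
  test_function phi -> 0 < c ->
  \int[gamma]_z (tnth z j * phi (c *: row_of_tuple z)) =
  c * \int[gamma]_z partial j phi (c *: row_of_tuple z).
Proof.
move=> tphi c0.
have [M M0 phiM] := test_function_bounded tphi.
have [K K0 phiK] := test_function_support tphi.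
have tp := test_function_partial j tphi.
have cphi := test_function_continuous tphi.
have cp := test_function_continuous tp.
have mcoord : measurable_fun setT (fun z : n.-tuple R => tnth z j).
  exact: measurable_tnth.
(* The coordinate is unbounded, so integrability rests on the first absolute moment. *)
have iF : gamma.-integrable setT
    (EFin \o (fun z => tnth z j * phi (c *: row_of_tuple z))).
  apply: (@le_integrable _ _ _ gamma _ measurableT _
    (fun z => M%:E * `|tnth z j|%:E)%E).
  - apply/measurable_EFinP/measurable_funM => //.
    exact: measurable_continuous_row_scale.
  - move=> z _; rewrite /= lee_fin normrM normrM normr_id mulrC.
    by rewrite ler_wpM2r// (le_trans (phiM _))// ler_norm.
  - by apply: integrableZl => //; exact: integrable_abs_coord.
rewrite -RintegralZl//; last exact: integrable_gauss_test.
have iF' : gamma.-integrable setT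
    (EFin \o (fun z => c * partial j phi (c *: row_of_tuple z))).
  exact: (integrableZl measurableT c (integrable_gauss_test c tp)).
rewrite /Rintegral; congr fine.
rewrite (integral_gauss_tuple_resample j iF).
rewrite (integral_gauss_tuple_resample j iF').
apply: eq_integral => z _ /=.
pose y := c *: row_of_tuple z.
pose f u := phi (set_coord y j (c * u)).
pose f' u := c * partial j phi (set_coord y j (c * u)).
have df (u : R) : is_derive u 1 f (f' u).
  have dc : is_derive u 1 (fun u : R => c * u) c.
    have /is_derive_eq := is_deriveZ c (is_derive_id u (1 : R)).
    by apply; rewrite /GRing.scale/= mulr1.
  have := is_derive1_comp (is_derive_set_coord y (c * u)
    (fun z => @test_function_derivable _ _ _ tphi j z)) dc.
  by rewrite mulrC.
have cset : continuous (fun u => set_coord y j (c * u)).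
  move=> u; apply: (@continuous_comp _ _ _ (fun u => c * u) (set_coord y j)).
    exact: mulrl_continuous.
  exact: continuous_set_coord.
have cf : continuous f.
  by move=> u; apply: continuous_comp; [exact: cset|exact: cphi].
have cf' : continuous f'.
  move=> u; apply: cvgM; first exact: cvg_cst.
  by apply: continuous_comp; [exact: cset|exact: cp].
(* [phi] vanishes once its [j]-th coordinate c u exceeds K in modulus. *)
have f0 u : K / c < `|u| -> f u = 0.
  rewrite ltr_pdivrMr// => Ku; apply: (phiK _ j).
  by rewrite mxE eqxx normrM gtr0_norm// mulrC.
have [M' M'0 pM'] := test_function_bounded tp.
have if' : N.-integrable setT (EFin \o f').
  apply: measurable_bounded_integrable => //.
  - by rewrite (le_lt_trans (probability_le1 N measurableT)) ?ltry.
  - exact: continuous_measurable_fun.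
  - exists (c * M'); split; first exact: num_real.
    move=> r Mr u _; apply: le_trans (ltW Mr).
    by rewrite normrM gtr0_norm// ler_wpM2l// ltW.
have iuf : N.-integrable setT (EFin \o (fun u => u * f u)).
  apply: (@le_integrable _ _ _ N _ measurableT _
    (fun u => M%:E * `|u|%:E)%E).
  - by apply/measurable_EFinP/measurable_funM => //; exact: continuous_measurable_fun.
  - move=> u _; rewrite /= lee_fin normrM normrM normr_id mulrC.
    by rewrite ler_wpM2r// (le_trans (phiM _))// ler_norm.
  - by apply: integrableZl => //; exact: integrable_abs_normal.
have S := stein (divr_gt0 K0 c0) df cf' f0.
transitivity (\int[N]_u (EFin \o (fun u : R => (u * f u)%R)) u)%E.
  apply: eq_integral => u _.
  by rewrite /= tnth_tuple_set eqxx row_of_tuple_set scale_set_coord.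
transitivity (\int[N]_u (EFin \o f') u)%E; last first.
  apply: eq_integral => u _.
  by rewrite /= row_of_tuple_set scale_set_coord.
rewrite -[LHS]fineK ?integrable_fin_num// -[RHS]fineK ?integrable_fin_num//.
by congr EFin; exact: S.
Qed.

Lemma is_derive_scale_row phi (x : 'rV[R]_n) (c : R) : test_function phi ->
  is_derive c 1 (fun r : R => phi (r *: x))
    (\sum_j x 0 j * partial j phi (c *: x)).
Proof.
move=> tphi.
have d : is_derive (c *: x) x phi (\sum_j x 0 j * partial j phi (c *: x)).
  apply: is_derive_row; first exact: test_function_derivable.
  move=> j; exact/test_function_continuous/test_function_partial.
have dx : derivable phi (c *: x + 0) x by rewrite addr0; exact: ex_derive.
have := is_derive_line dx; rewrite addr0 derive_val.
by under eq_fun do rewrite addr0.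
Qed.

(** Differentiation under the integral gives E of the sum of Z_j times the [j]-th partial at c Z;
    integrating by parts in each coordinate trades Z_j for c times a second derivative. *)
Lemma is_derive_gauss_mean phi (c : R) : test_function phi -> 0 < c ->
  is_derive c 1 (gauss_mean phi)
    (c * \sum_j gauss_mean (partial j (partial j phi)) c).
Proof.
move=> tphi c0.
have tp j := test_function_partial j tphi.
have tpp j := test_function_partial j (tp j).
have bp j := test_function_bounded (tp j).
pose f (r : R) (z : n.-tuple R) := phi (r *: row_of_tuple z).
have df (r : R) (z : n.-tuple R) : is_derive r 1 (f ^~ z)
    (\sum_j tnth z j * partial j phi (r *: row_of_tuple z)).
  have := is_derive_scale_row (row_of_tuple z) r tphi.
  by move/is_derive_eq; apply; apply: eq_bigr => j _; rewrite mxE.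
have d1f r z : partial1of2 f r z =
    \sum_j tnth z j * partial j phi (r *: row_of_tuple z).
  by rewrite partial1of2E; exact: derive_val.
pose M j := s2val (cid2 (bp j)).
have M0 j : 0 < M j by exact: (s2valP (cid2 (bp j))).
have pM j x : `|partial j phi x| <= M j by exact: (s2valP' (cid2 (bp j))).
(* The dominating function: it does not depend on [r] and has a finite mean. *)
pose G (z : n.-tuple R) := \sum_j M j * `|tnth z j|.
have iG : gamma.-integrable setT (EFin \o G).
  rewrite (_ : _ \o _ = (fun z => \sum_j (M j)%:E * `|tnth z j|%:E)%E); last first.
    by apply/funext => z; rewrite /= /G -sumEFin.
  apply: integrable_sum => // j _; apply: integrableZl => //.
  exact: integrable_abs_coord.
have Ic : `]c - 1, c + 1[%classic c.
  by rewrite /= in_itv/= ltrBlDr ltrDl ltr01.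
have intf x : `]c - 1, c + 1[%classic x -> gamma.-integrable setT (EFin \o f x).
  by move=> _; exact: integrable_gauss_test.
have derf x y : `]c - 1, c + 1[%classic x -> setT y -> derivable (f ^~ y) x 1.
  by move=> _ _; have := df x y => ?; exact: ex_derive.
have Gub x y : `]c - 1, c + 1[%classic x -> setT y -> `|partial1of2 f x y| <= G y.
  move=> _ _; rewrite d1f; apply: (le_trans (ler_norm_sum _ _ _)).
  by apply: ler_sum => j _; rewrite normrM mulrC ler_wpM2r.
have G0 y : 0 <= G y by apply: sumr_ge0 => j _; rewrite mulr_ge0// ltW.
have dF := @derivable_under_integral R _ _ gamma f setT measurableT c _ _
  Ic intf derf G G0 iG Gub.
have DF := @differentiation_under_integral R _ _ gamma f setT measurableT c _ _
  Ic intf derf G G0 iG Gub.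
apply: DeriveDef; first exact: dF.
rewrite -derive1E [LHS]DF.
under eq_Rintegral do rewrite d1f.
transitivity (\sum_j \int[gamma]_z (tnth z j * partial j phi (c *: row_of_tuple z))).
  apply: Rintegral_sum => // j.
  apply: (@le_integrable _ _ _ gamma _ measurableT _
    (fun z => (M j)%:E * `|tnth z j|%:E)%E).
  - apply/measurable_EFinP/measurable_funM; first exact: measurable_tnth.
    by apply: measurable_continuous_row_scale; exact: test_function_continuous.
  - move=> z _; rewrite /= lee_fin normrM normrM normr_id mulrC.
    by rewrite ler_wpM2r// (le_trans (pM _ _))// ler_norm.
  - by apply: integrableZl => //; exact: integrable_abs_coord.
rewrite mulr_sumr; apply: eq_bigr => j _.
exact: gauss_integration_by_parts.
Qed.

End gauss_mean.

Section heat.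
Context {R : realType} (n : nat).
Implicit Types phi : 'rV[R]_n -> R.

Definition heat phi (s : R) : R := gauss_mean phi (Num.sqrt s).

Lemma heat0 phi : heat phi 0 = phi 0.
Proof. by rewrite /heat sqrtr0 gauss_mean0. Qed.

Lemma heat_bounded phi (M : R) : continuous phi -> (forall x, `|phi x| <= M) ->
  forall s, `|heat phi s| <= M.
Proof. by move=> cphi phiM s; exact: gauss_mean_bounded. Qed.

Lemma continuous_heat phi (M : R) : continuous phi ->
  (forall x, `|phi x| <= M) -> continuous (heat phi).
Proof.
move=> cphi phiM s; apply: (@continuous_comp _ _ _ (@Num.sqrt R) (gauss_mean phi)).
  exact: sqrt_continuous.
exact: continuous_gauss_mean phiM _.
Qed.

(** The factor c = sqrt(s) of the derivative in [c] cancels against the derivative 1 / (2 sqrt(s))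
    of the square root, leaving 1/2. *)
Lemma is_derive_heat phi (s : R) : test_function phi -> 0 < s ->
  is_derive s 1 (heat phi)
    (2^-1 * \sum_j heat (partial j (partial j phi)) s).
Proof.
move=> tphi s0; have ss0 : 0 < Num.sqrt s by rewrite sqrtr_gt0.
have /is_derive_eq :=
  is_derive1_comp (is_derive_gauss_mean tphi ss0) (is_derive1_sqrt s0).
by apply; rewrite /heat; field; rewrite gt_eqF.
Qed.

End heat.

(** * The Poisson kernel of the half-plane, up to 1/pi, and its derivatives *)

Section poisson_kernel.
Context {R : realType}.
Local Notation kappa := (fun s : R => (oneDsqr s)^-1).

Definition poisson (t s : R) : R := t / (t ^+ 2 + s ^+ 2).
Definition poisson_t (t s : R) : R :=
  (s ^+ 2 - t ^+ 2) / (t ^+ 2 + s ^+ 2) ^+ 2.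
Definition poisson_s (t s : R) : R :=
  - (2 * t * s) / (t ^+ 2 + s ^+ 2) ^+ 2.
Definition poisson_tt (t s : R) : R :=
  2 * t * (t ^+ 2 - 3 * s ^+ 2) / (t ^+ 2 + s ^+ 2) ^+ 3.

Let den_gt0 (t s : R) : 0 < t -> 0 < t ^+ 2 + s ^+ 2.
Proof. by move=> t0; rewrite ltr_pwDl ?sqr_ge0// exprn_gt0. Qed.

Let is_derive_denl (t s : R) : is_derive t 1 (fun t : R => t ^+ 2 + s ^+ 2) (2 * t).
Proof.
have /is_derive_eq := is_deriveD (is_deriveX 2 (is_derive_id t (1 : R)))
  (is_derive_cst (s ^+ 2) t (1 : R)).
by apply; rewrite /GRing.scale/= addr0 expr1 mulr1.
Qed.

Let is_derive_denr (t s : R) : is_derive s 1 (fun s : R => t ^+ 2 + s ^+ 2) (2 * s).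
Proof.
have /is_derive_eq := is_deriveD (is_derive_cst (t ^+ 2) s (1 : R))
  (is_deriveX 2 (is_derive_id s (1 : R))).
by apply; rewrite /GRing.scale/= add0r expr1 mulr1.
Qed.

Lemma is_derive_quotient (f g : R -> R) (x df dg : R) : g x != 0 ->
  is_derive x 1 f df -> is_derive x 1 g dg ->
  is_derive x 1 (fun y => f y / g y) ((df * g x - f x * dg) / g x ^+ 2).
Proof.
move=> gx0 dfx dgx; have /is_derive_eq := is_deriveM dfx (is_deriveV gx0 dgx).
by apply; rewrite /GRing.scale/=; field.
Qed.

Lemma is_derive_poisson_t (t s : R) : 0 < t ->
  is_derive t 1 (poisson ^~ s) (poisson_t t s).
Proof.
move=> t0; have d0 := den_gt0 s t0.
have /is_derive_eq := is_derive_quotient (g := fun t => t ^+ 2 + s ^+ 2) (lt0r_neq0 d0)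
  (is_derive_id t (1 : R)) (is_derive_denl t s).
by apply; rewrite /poisson_t; congr (_ / _); ring.
Qed.

Lemma is_derive_poisson_s (t s : R) : 0 < t ->
  is_derive s 1 (poisson t) (poisson_s t s).
Proof.
move=> t0; have d0 := den_gt0 s t0.
have /is_derive_eq := is_derive_quotient (g := fun s => t ^+ 2 + s ^+ 2) (lt0r_neq0 d0)
  (is_derive_cst t s (1 : R)) (is_derive_denr t s).
by apply; rewrite /poisson_s /cst; congr (_ / _); ring.
Qed.

Lemma is_derive_poisson_tt (t s : R) : 0 < t ->
  is_derive t 1 (poisson_t ^~ s) (poisson_tt t s).
Proof.
move=> t0; have d0 := den_gt0 s t0.
have dnum : is_derive t 1 (fun t : R => s ^+ 2 - t ^+ 2) (- (2 * t)).
  have /is_derive_eq := is_deriveB (is_derive_cst (s ^+ 2) t (1 : R))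
    (is_deriveX 2 (is_derive_id t (1 : R))).
  by apply; rewrite /GRing.scale/= sub0r expr1 mulr1.
have dden := is_deriveX 2 (is_derive_denl t s).
have /is_derive_eq := is_derive_quotient
  (g := (fun t => t ^+ 2 + s ^+ 2) ^+ 2) (expf_neq0 2 (lt0r_neq0 d0)) dnum dden.
by apply; rewrite /poisson_tt /GRing.scale/= fctE expr1; field; rewrite gt_eqF.
Qed.

(** Harmonicity of the kernel, in the form in which it is later integrated by parts. *)
Lemma is_derive_poisson_ss (t s : R) : 0 < t ->
  is_derive s 1 (poisson_s t) (- poisson_tt t s).
Proof.
move=> t0; have d0 := den_gt0 s t0.
have dnum : is_derive s 1 (fun s : R => - (2 * t * s)) (- (2 * t)).
  have /is_derive_eq := is_deriveN (is_deriveZ (2 * t) (is_derive_id s (1 : R))).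
  by apply; rewrite /GRing.scale/= mulr1.
have dden := is_deriveX 2 (is_derive_denr t s).
have /is_derive_eq := is_derive_quotient
  (g := (fun s => t ^+ 2 + s ^+ 2) ^+ 2) (expf_neq0 2 (lt0r_neq0 d0)) dnum dden.
by apply; rewrite /poisson_tt /GRing.scale/= fctE expr1; field; rewrite gt_eqF.
Qed.

(** A bound uniform in t >= u: (1 + u^-2)(u^2 + s^2) exceeds 1 + s^2 by u^2 + s^2 / u^2. *)
Lemma den_inv_le (u t s : R) : 0 < u -> u <= t ->
  (t ^+ 2 + s ^+ 2)^-1 <= (1 + u ^- 2) * kappa s.
Proof.
move=> u0 ut; have t0 := lt_le_trans u0 ut.
have k0 : 0 < oneDsqr s by rewrite (lt_le_trans ltr01)// oneDsqr_ge1.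
rewrite -[leLHS]mul1r ler_pdivrMr ?den_gt0// mulrAC ler_pdivlMr// mul1r.
apply: (@le_trans _ _ ((1 + u ^- 2) * (u ^+ 2 + s ^+ 2))); last first.
  rewrite ler_wpM2l ?addr_ge0 ?invr_ge0 ?exprn_ge0// ?(ltW u0)// lerD2r.
  by rewrite lerXn2r ?nnegrE// ltW.
rewrite /oneDsqr mulrDl mul1r mulrDr mulVf ?expf_neq0 ?gt_eqF//.
rewrite -subr_ge0.
rewrite (_ : _ - _ = u ^+ 2 + u ^- 2 * s ^+ 2); last by ring.
by rewrite addr_ge0 ?sqr_ge0// mulr_ge0 ?sqr_ge0// invr_ge0 sqr_ge0.
Qed.

Let kernel_boundE (t s : R) (x : R) : 0 < t -> `|x| <= t ^+ 2 + s ^+ 2 ->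
  `|x / (t ^+ 2 + s ^+ 2) ^+ 2| <= (t ^+ 2 + s ^+ 2)^-1.
Proof.
move=> t0 xd; have d0 := den_gt0 s t0.
rewrite normrM [X in _ * X]gtr0_norm ?invr_gt0 ?exprn_gt0// expr2 invfM mulrA.
by rewrite ler_piMl ?invr_ge0 ?(ltW d0)// ler_pdivrMr// mul1r.
Qed.

Lemma poisson_le (t s : R) : 0 < t ->
  `|poisson t s| <= t * (t ^+ 2 + s ^+ 2)^-1.
Proof.
move=> t0; have d0 := den_gt0 s t0.
by rewrite ger0_norm// divr_ge0 ?(ltW t0) ?(ltW d0).
Qed.

Lemma poisson_t_le (t s : R) : 0 < t ->
  `|poisson_t t s| <= (t ^+ 2 + s ^+ 2)^-1.
Proof.
move=> t0; apply: kernel_boundE => //.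
by rewrite ler_norml; apply/andP; split; nra.
Qed.

Lemma poisson_s_le (t s : R) : 0 < t ->
  `|poisson_s t s| <= (t ^+ 2 + s ^+ 2)^-1.
Proof.
move=> t0; apply: kernel_boundE => //.
have h1 := sqr_ge0 (t - s); have h2 := sqr_ge0 (t + s).
by rewrite ler_norml; apply/andP; split; nra.
Qed.

(** The constant comes from t^2 <= t^2 + s^2 and |t^2 - 3 s^2| <= 3 (t^2 + s^2): the numerator
    absorbs all but one power of the denominator, at the cost of 6/t. *)
Lemma poisson_tt_le (t s : R) : 0 < t ->
  `|poisson_tt t s| <= 6 / t * (t ^+ 2 + s ^+ 2)^-1.
Proof.
move=> t0; have d0 := den_gt0 s t0.
rewrite (_ : poisson_tt t s = 6 / t *
    ((t ^+ 2 * (t ^+ 2 - 3 * s ^+ 2) / 3 / (t ^+ 2 + s ^+ 2)) /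
      (t ^+ 2 + s ^+ 2) ^+ 2)); last first.
  by rewrite /poisson_tt; field; rewrite !gt_eqF.
rewrite normrM gtr0_norm ?divr_gt0// ler_wpM2l ?divr_ge0 ?(ltW t0)//.
apply: kernel_boundE => //.
rewrite normrM [X in _ * X]gtr0_norm ?invr_gt0// ler_pdivrMr//.
by rewrite ler_norml; apply/andP; split; nra.
Qed.

Let continuous_den (t : R) : continuous (fun s : R => t ^+ 2 + s ^+ 2).
Proof.
move=> s; apply: cvgD; first exact: cvg_cst.
exact: exprn_continuous.
Qed.

Let continuous_den_inv (t : R) k : 0 < t ->
  continuous (fun s : R => (t ^+ 2 + s ^+ 2) ^- k).
Proof.
move=> t0 s; apply: cvgV; first by rewrite expf_neq0// gt_eqF// den_gt0.
have : {for s, continuous ((fun x : R => x ^+ k) \o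
    (fun s : R => t ^+ 2 + s ^+ 2))}.
  apply: continuous_comp; first exact: continuous_den.
  exact: exprn_continuous.
exact.
Qed.

Lemma continuous_poisson (t : R) : 0 < t -> continuous (poisson t).
Proof.
move=> t0 s; apply: cvgM; first exact: cvg_cst.
exact: (@continuous_den_inv t 1 t0 s).
Qed.

Lemma continuous_poisson_t (t : R) : 0 < t -> continuous (poisson_t t).
Proof.
move=> t0 s; apply: cvgM; last exact: (@continuous_den_inv t 2 t0 s).
by apply: cvgB; [exact: exprn_continuous|exact: cvg_cst].
Qed.

Lemma continuous_poisson_s (t : R) : 0 < t -> continuous (poisson_s t).
Proof.
move=> t0 s; apply: cvgM; last exact: (@continuous_den_inv t 2 t0 s).
by apply: cvgN; apply: cvgM; [exact: cvg_cst|exact: cvg_id].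
Qed.

Lemma continuous_poisson_tt (t : R) : 0 < t -> continuous (poisson_tt t).
Proof.
move=> t0 s; apply: cvgM; last exact: (@continuous_den_inv t 3 t0 s).
apply: cvgM; first exact: cvg_cst.
apply: cvgB; first exact: cvg_cst.
by apply: cvgM; [exact: cvg_cst|exact: exprn_continuous].
Qed.

End poisson_kernel.

(** * Integrals of bounded functions against the kernel *)

Section kernel_integral.
Context {R : realType}.
Local Notation mu := (@lebesgue_measure R).
Local Notation kappa := (fun s : R => (oneDsqr s)^-1).
Variables (h : R -> R) (M : R).
Hypotheses (ch : continuous h) (hM : forall s, `|h s| <= M).

Let M0 : 0 <= M. Proof. by rewrite (le_trans _ (hM 0)). Qed.

Let kappa_ge0 s : 0 <= kappa s.
Proof. by rewrite invr_ge0 (le_trans ler01)// oneDsqr_ge1. Qed.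

Let mul_bound (k : R -> R) (A : R) : (forall s, `|k s| <= A * kappa s) ->
  forall s, `|h s * k s| <= M * A * kappa s.
Proof.
by move=> kA s; rewrite normrM -mulrA; apply: ler_pM.
Qed.

Lemma integrable_mul_kernel (k : R -> R) (A : R) : continuous k ->
  (forall s, `|k s| <= A * kappa s) ->
  mu.-integrable `[0, +oo[ (EFin \o (fun s => h s * k s)).
Proof.
move=> ck kA; apply: (@integrable_le_oneDsqrV _ _ (M * A)); last first.
  by move=> s _; exact: mul_bound.
apply: measurable_funTS; apply: continuous_measurable_fun => s.
by apply: cvgM; [exact: ch|exact: ck].
Qed.

(** Restricting [r] to the window from t/2 to 2t keeps it away from 0, where the kernel is singular,
    so that one multiple of 1 / (1 + s^2) can dominate throughout. *)
Lemma is_derive_kernel_integral (k k' : R -> R -> R) (t A : R) : 0 < t ->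
  (forall r, t / 2 < r < 2 * t -> continuous (k r)) ->
  (forall r s, t / 2 < r < 2 * t -> `|k r s| <= A * kappa s) ->
  (forall r s : R, t / 2 < r < 2 * t -> is_derive r 1 (k ^~ s) (k' r s)) ->
  (forall r s, t / 2 < r < 2 * t -> `|k' r s| <= A * kappa s) ->
  is_derive t 1 (fun r : R => \int[mu]_(s in `[0, +oo[) (h s * k r s))
    (\int[mu]_(s in `[0, +oo[) (h s * k' t s)).
Proof.
move=> t0 ck kA dk k'A.
have It : `](t / 2), (2 * t)[%classic t by rewrite /= in_itv/=; lra.
have Iin r : `](t / 2), (2 * t)[%classic r -> t / 2 < r < 2 * t.
  by rewrite /= in_itv.
pose f (r s : R) := h s * k r s.
have df (r s : R) : t / 2 < r < 2 * t -> is_derive r 1 (f ^~ s) (h s * k' r s).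
  by move=> Ir; exact: (is_deriveZ (h s) (dk r s Ir)).
have d1f r s : t / 2 < r < 2 * t -> partial1of2 f r s = h s * k' r s.
  by move=> Ir; rewrite partial1of2E; have := df _ s Ir => ?; exact: derive_val.
pose G (s : R) := M * A * kappa s.
(* Read off the hypothesis at s = 0, where 1 / (1 + s^2) = 1. *)
have A0 : 0 <= A.
  have := kA t 0 (Iin _ It); rewrite /oneDsqr expr0n/= addr0 invr1 mulr1.
  exact: le_trans.
have G0 s : 0 <= G s by rewrite mulr_ge0// mulr_ge0.
have mI : measurable (`[0%R, +oo[%classic : set (measurableTypeR R)) by [].
have iG : mu.-integrable `[0, +oo[ (EFin \o G).
  exact: (integrableZl mI (M * A) integrable_oneDsqrV).
have intf r : `](t / 2), (2 * t)[%classic r ->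
    mu.-integrable `[0, +oo[ (EFin \o f r).
  move=> /Iin Ir; apply: (integrable_mul_kernel (A := A)); first exact: ck.
  by move=> s; exact: kA.
have derf r s : `](t / 2), (2 * t)[%classic r -> `[0, +oo[%classic s ->
    derivable (f ^~ s) r 1.
  by move=> /Iin Ir _; have := df _ s Ir => ?; exact: ex_derive.
have Gub r s : `](t / 2), (2 * t)[%classic r -> `[0, +oo[%classic s ->
    `|partial1of2 f r s| <= G s.
  by move=> /Iin Ir _; rewrite d1f//; apply: mul_bound => s'; exact: k'A.
have dF := @derivable_under_integral R _ _ mu f `[0, +oo[%classic mI t _ _
  It intf derf G G0 iG Gub.
have DF := @differentiation_under_integral R _ _ mu f `[0, +oo[%classic mI t _ _
  It intf derf G G0 iG Gub.
apply: DeriveDef; first exact: dF.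
rewrite -derive1E [LHS]DF.
by apply: eq_Rintegral => s _; rewrite d1f//; exact: Iin.
Qed.

(** The terms serve q, then q_t and q_s, then q_tt, using t/2 < r < 2t and [den_inv_le] at u = t/2.
    Their sum bounds all four kernels at once. *)
Let bound (t : R) := 2 * t * (1 + (t / 2) ^- 2) + (1 + (t / 2) ^- 2)
  + 6 / (t / 2) * (1 + (t / 2) ^- 2).

Let bounds (t r s : R) : 0 < t -> t / 2 < r < 2 * t ->
  [/\ `|poisson r s| <= bound t * kappa s,
      `|poisson_t r s| <= bound t * kappa s,
      `|poisson_s r s| <= bound t * kappa s &
      `|poisson_tt r s| <= bound t * kappa s].
Proof.
move=> t0 /andP[tr rt]; have t20 : 0 < t / 2 by rewrite divr_gt0.
have r0 := lt_trans t20 tr.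
have D := den_inv_le s t20 (ltW tr).
set d := (r ^+ 2 + s ^+ 2)^-1 in D *; set b := 1 + (t / 2) ^- 2 in D *.
have d0 : 0 <= d by rewrite invr_ge0 addr_ge0 ?sqr_ge0.
have b0 : 0 <= b by rewrite addr_ge0 ?invr_ge0 ?sqr_ge0.
have k0 := kappa_ge0 s.
have t60 : 0 <= 6 / (t / 2) by rewrite divr_ge0 ?(ltW t20).
have e : bound t * kappa s =
    2 * t * (b * kappa s) + b * kappa s + 6 / (t / 2) * (b * kappa s).
  by rewrite /bound -/b; ring.
have bk0 : 0 <= b * kappa s by rewrite mulr_ge0.
have p1 : 0 <= 2 * t * (b * kappa s) by rewrite mulr_ge0// mulr_ge0// ltW.
have p2 : 0 <= 6 / (t / 2) * (b * kappa s) by rewrite mulr_ge0.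
have l1 : b * kappa s <= bound t * kappa s by rewrite e; lra.
split.
- apply: (le_trans (poisson_le s r0)).
  apply: (@le_trans _ _ (2 * t * (b * kappa s))); last by rewrite e; lra.
  by rewrite ler_pM// ltW.
- exact: le_trans (poisson_t_le s r0) (le_trans D l1).
- exact: le_trans (poisson_s_le s r0) (le_trans D l1).
- apply: (le_trans (poisson_tt_le s r0)).
  apply: (@le_trans _ _ (6 / (t / 2) * (b * kappa s))); last by rewrite e; lra.
  rewrite ler_pM// ?divr_ge0 ?(ltW r0)//.
  by rewrite ler_wpM2l// lef_pV2 ?posrE// ltW.
Qed.

Let half_gt0 (t r : R) : 0 < t -> t / 2 < r < 2 * t -> 0 < r.
Proof. by move=> t0 /andP[tr _]; rewrite (lt_trans _ tr)// divr_gt0. Qed.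

Lemma poisson_bound (t : R) : 0 < t ->
  exists A : R, forall s : R, [/\ `|poisson t s| <= A * kappa s,
    `|poisson_s t s| <= A * kappa s & `|poisson_tt t s| <= A * kappa s].
Proof.
move=> t0; exists (bound t) => s.
have tt : t / 2 < t < 2 * t by lra.
by have [? ? ? ?] := bounds s t0 tt.
Qed.

Lemma is_derive_poisson_integral (t : R) : 0 < t ->
  is_derive t 1 (fun r : R => \int[mu]_(s in `[0, +oo[) (h s * poisson r s))
    (\int[mu]_(s in `[0, +oo[) (h s * poisson_t t s)).
Proof.
move=> t0; apply: (@is_derive_kernel_integral poisson poisson_t t (bound t)) => //.
- by move=> r /(half_gt0 t0) r0; exact: continuous_poisson.
- by move=> r s Ir; have [] := bounds s t0 Ir.
- by move=> r s /(half_gt0 t0) r0; exact: is_derive_poisson_t.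
- by move=> r s Ir; have [] := bounds s t0 Ir.
Qed.

Lemma is_derive_poisson_t_integral (t : R) : 0 < t ->
  is_derive t 1 (fun r : R => \int[mu]_(s in `[0, +oo[) (h s * poisson_t r s))
    (\int[mu]_(s in `[0, +oo[) (h s * poisson_tt t s)).
Proof.
move=> t0; apply: (@is_derive_kernel_integral poisson_t poisson_tt t (bound t)) => //.
- by move=> r /(half_gt0 t0) r0; exact: continuous_poisson_t.
- by move=> r s Ir; have [] := bounds s t0 Ir.
- by move=> r s /(half_gt0 t0) r0; exact: is_derive_poisson_tt.
- by move=> r s Ir; have [] := bounds s t0 Ir.
Qed.

Lemma integrable_poisson (t : R) : 0 < t ->
  mu.-integrable `[0, +oo[ (EFin \o (fun s => h s * poisson t s)).
Proof.
move=> t0; have [A hA] := poisson_bound t0.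
apply: (integrable_mul_kernel (A := A)); first exact: continuous_poisson.
by move=> s; have [] := hA s.
Qed.

Lemma integrable_poisson_tt (t : R) : 0 < t ->
  mu.-integrable `[0, +oo[ (EFin \o (fun s => h s * poisson_tt t s)).
Proof.
move=> t0; have [A hA] := poisson_bound t0.
apply: (integrable_mul_kernel (A := A)); first exact: continuous_poisson_tt.
by move=> s; have [] := hA s.
Qed.

End kernel_integral.

(** * Two integrations by parts in s *)

Section kernel_by_parts.
Context {R : realType}.
Local Notation mu := (@lebesgue_measure R).
Local Notation kappa := (fun s : R => (oneDsqr s)^-1).

Lemma cvgy_oneDsqrV : kappa s @[s --> +oo] --> (0 : R).
Proof.
apply/cvgrPdist_le => e e0; near=> s.
have s0 : 0 < s by near: s; exact: nbhs_pinfty_gt.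
rewrite sub0r normrN ger0_norm ?invr_ge0 ?(le_trans ler01) ?oneDsqr_ge1//.
apply: (@le_trans _ _ s^-1).
  rewrite lef_pV2 ?posrE// ?(lt_le_trans ltr01) ?oneDsqr_ge1//.
  by rewrite /oneDsqr; nra.
rewrite -[leRHS]invrK lef_pV2 ?posrE ?invr_gt0//.
Unshelve. all: by end_near. Qed.

(** One application of the fundamental theorem to W = h q_s - h1 q does both integrations: the
    products h1 q_s cancel in W'. Derivatives are asked for at s > 0 only, and continuity supplies
    the value of [h1] at 0. *)
Lemma poisson_integration_by_parts (h h1 h2 : R -> R) (M t : R) : 0 < t ->
  continuous h -> continuous h1 -> continuous h2 ->
  (forall s, `|h s| <= M) -> (forall s, `|h1 s| <= M) ->
  (forall s, `|h2 s| <= M) ->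
  (forall s : R, 0 < s -> is_derive s 1 h (h1 s)) ->
  (forall s : R, 0 < s -> is_derive s 1 h1 (h2 s)) ->
  \int[mu]_(s in `[0, +oo[) (h s * poisson_tt t s) =
  - (h1 0 / t) - \int[mu]_(s in `[0, +oo[) (h2 s * poisson t s).
Proof.
move=> t0 ch ch1 ch2 hM h1M h2M dh dh1.
have [A hA] := poisson_bound t0.
have M0 : 0 <= M by rewrite (le_trans _ (hM 0)).
have k0 s : 0 <= kappa s by rewrite invr_ge0 (le_trans ler01)// oneDsqr_ge1.
(* W' = - (h q_tt + h2 q) because q_ss = - q_tt. *)
pose W s := h s * poisson_s t s - h1 s * poisson t s.
pose w s := - (h s * poisson_tt t s + h2 s * poisson t s).
have wM s : 0 <= s -> `|w s| <= (M * A + M * A) * kappa s.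
  move=> _; have [p1 p2 p3] := hA s.
  rewrite /w normrN (le_trans (ler_normD _ _))// [leRHS]mulrDl.
  by apply: lerD; rewrite [leLHS]normrM -mulrA ler_pM.
have cW : continuous W.
  move=> s; apply: cvgB; apply: cvgM; [exact: ch|exact: continuous_poisson_s|
    exact: ch1|exact: continuous_poisson].
have cw : continuous w.
  move=> s; apply: cvgN; apply: cvgD; apply: cvgM; [exact: ch|
    exact: continuous_poisson_tt|exact: ch2|exact: continuous_poisson].
have Wy : W s @[s --> +oo] --> 0.
  apply: norm_cvg0.
  apply: (@squeeze_cvgr _ _ _ _ (cst 0) (fun s => (M * A + M * A) * kappa s)).
  - apply: nearW => s; rewrite normr_ge0/=; have [p1 p2 p3] := hA s.
    rewrite /W (le_trans (ler_normB _ _))// [leRHS]mulrDl.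
    by apply: lerD; rewrite [leLHS]normrM -mulrA ler_pM.
  - exact: cvg_cst.
  - rewrite -(mulr0 (M * A + M * A)); apply: cvgM; first exact: cvg_cst.
    exact: cvgy_oneDsqrV.
have dW (s : R) : 0 < s -> is_derive s 1 W (w s).
  move=> s0; have d1 := dh s s0; have d2 := dh1 s s0.
  have p1 := is_derive_poisson_s s t0; have p2 := is_derive_poisson_ss s t0.
  have /is_derive_eq := is_deriveB (is_deriveM d1 p2) (is_deriveM d2 p1).
  by apply; rewrite /w /GRing.scale/=; ring.
have := Rintegral_FTC2y wM (continuous_subspaceT cw) Wy dW
  (cvg_at_right_filter (cW 0)).
(* At s = 0 one has q_s = 0 and q = 1/t, so only [h1 0] survives. *)
rewrite (_ : 0 - W 0 = h1 0 / t); last first.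
  by rewrite /W /poisson_s /poisson mulr0 oppr0 mul0r mulr0 expr0n/=; field; rewrite gt_eqF.
move=> <-.
have i1 := integrable_poisson_tt ch hM t0; have i2 := integrable_poisson ch2 h2M t0.
have mI : measurable (`[0%R, +oo[%classic : set (measurableTypeR R)) by [].
rewrite (_ : - (\int[mu]_(s in `[0, +oo[) w s) =
  \int[mu]_(s in `[0, +oo[) (h s * poisson_tt t s) +
  \int[mu]_(s in `[0, +oo[) (h2 s * poisson t s)); first by rewrite addrK.
rewrite -RintegralD// -mulN1r -RintegralZl//.
  by apply: eq_Rintegral => s _; rewrite /w mulN1r opprK.
apply: (integrable_le_oneDsqrV (M := M * A + M * A)); last exact: wM.
by apply: measurable_funTS; exact: continuous_measurable_fun.
Qed.

End kernel_by_parts.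

Lemma continuous_bigsum (R : realType) (I : Type) (r : seq I) (f : I -> R -> R) :
  (forall i, continuous (f i)) -> continuous (fun s => \sum_(i <- r) f i s).
Proof.
move=> cf; elim: r => [|i r IHr] s.
  rewrite (_ : (fun s => _) = cst 0); first exact: cvg_cst.
  by apply/funext => u; rewrite big_nil.
rewrite (_ : (fun s => _) = (fun s => f i s + \sum_(i <- r) f i s)).
  by apply: cvgD; [exact: cf|exact: IHr].
by apply/funext => u; rewrite big_cons.
Qed.

Lemma integral_scale (R : realType) (c : R) (F : R -> \bar R) : 0 < c ->
  measurable_fun setT F ->
  (\int[lebesgue_measure]_x F x =
   \int[lebesgue_measure]_x (c%:E * F (c * x)%R))%E.
Proof.
move=> c0 mF; rewrite integralE [RHS]integralE.
have mFp := measurable_funepos mF; have mFn := measurable_funeneg mF.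
rewrite (ge0_integral_scale c0 mFp)// (ge0_integral_scale c0 mFn)//.
by congr (_ - _)%E; apply: eq_integral => x _;
  [rewrite !funeposE|rewrite !funenegE -muleN];
  rewrite maxe_pMr ?lee_fin ?(ltW c0)// mule0.
Qed.

(** * The equation *)

Section regular_distribution.
Context {R : realType} (n : nat).
Implicit Types phi : 'rV[R]_n -> R.
Local Notation mu := (@lebesgue_measure R).
Local Notation kappa := (fun s : R => (oneDsqr s)^-1).
Local Notation mean phi t :=
  (2 / pi * \int[mu]_(s in `[0, +oo[) (heat phi s * poisson t s)).

Lemma ge0_integral_p_BC_continuous phi (M t : R) : 0 < t -> continuous phi ->
  (forall x, 0 <= phi x) -> (forall x, `|phi x| <= M) ->
  (\int[lebesgue_tuple R n]_x (@p_BC R n t x * (phi (row_of_tuple x))%:E) =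
   (mean phi t)%:E)%E.
Proof.
move=> t0 cphi phi0 phiM.
have mphi := measurable_continuous_row cphi.
rewrite (ge0_integral_p_BC t0 (psi := fun x => (phi (row_of_tuple x))%:E));
  last 2 first.
- exact/measurable_EFinP.
- by move=> x; rewrite lee_fin.
have hE s : (\int[gauss_tuple R n]_z
    (phi (row_of_tuple (tuple_scale (Num.sqrt s) z)))%:E = (heat phi s)%:E)%E.
  rewrite /heat /gauss_mean /Rintegral fineK.
    by apply: eq_integral => z _; rewrite row_of_tuple_scale.
  by apply: integrable_fin_num => //; exact: (integrable_gauss_mean cphi phiM).
have ip := integrable_poisson (continuous_heat cphi phiM) (heat_bounded cphi phiM) t0.
have mI : measurable (`[0%R, +oo[%classic : set (measurableTypeR R)) by [].
transitivity (\int[mu]_(s in `[0%R, +oo[)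
    ((2 / pi)%:E * (EFin \o (fun s => heat phi s * poisson t s)%R) s))%E; last first.
  rewrite (integralZl mI ip) [RHS]EFinM; congr (_ * _)%E.
  by rewrite /Rintegral fineK// integrable_fin_num.
(* Passing between the open and the closed half-line costs only the null set {0}. *)
rewrite -integral_itv_obnd_cbnd; last first.
  have [mp _] := integrableP _ _ _ (integrableZl mI (2 / pi) ip).
  apply: measurable_funS mp => // s /=; rewrite !in_itv/= !andbT.
  exact: ltW.
rewrite (_ : [set s : R | 0 < s] = `]0%R, +oo[%classic); last first.
  by apply/seteqP; split => s /=; rewrite in_itv/= andbT.
apply: eq_integral => s _; rewrite hE -EFinM; congr EFin.
by rewrite /= /poisson; ring.
Qed.

Lemma regular_distr_p_BC phi (M t : R) : 0 < t -> continuous phi ->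
  (forall x, `|phi x| <= M) -> regular_distr (@p_BC R n t) phi = mean phi t.
Proof.
move=> t0 cphi phiM.
(* p may be +oo on a null set, so phi is split into its positive and negative
   parts instead of being shifted by a constant. *)
pose phip x := (`|phi x| + phi x) / 2; pose phin x := (`|phi x| - phi x) / 2.
have cnorm : continuous (fun x => `|phi x|).
  by move=> x; apply: continuous_comp; [exact: cphi|exact: norm_continuous].
have cphip : continuous phip.
  move=> x; apply: (@continuousM _ _ (fun x => `|phi x| + phi x) (cst 2^-1)).
    by apply: continuousD; [exact: cnorm|exact: cphi].
  exact: cst_continuous.
have cphin : continuous phin.
  move=> x; apply: (@continuousM _ _ (fun x => `|phi x| - phi x) (cst 2^-1)).
    by apply: continuousB; [exact: cnorm|exact: cphi].
  exact: cst_continuous.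
have phip0 x : 0 <= phip x.
  by rewrite /phip; have := ler_norm (- phi x); rewrite normrN => ?; lra.
have phin0 x : 0 <= phin x by rewrite /phin; have := ler_norm (phi x) => ?; lra.
have phipM x : `|phip x| <= M.
  rewrite ger0_norm//; apply: le_trans (phiM x).
  by rewrite /phip; have := ler_norm (phi x) => ?; lra.
have phinM x : `|phin x| <= M.
  rewrite ger0_norm//; apply: le_trans (phiM x).
  by rewrite /phin; have := ler_norm (- phi x); rewrite normrN => ?; lra.
rewrite /regular_distr -/(row_of_tuple _) integralE.
have p0 x := @p_BC_ge0 R n t t0 x.
transitivity (fine (\int[lebesgue_tuple R n]_x
      (@p_BC R n t x * (phip (row_of_tuple x))%:E) -
    \int[lebesgue_tuple R n]_x
      (@p_BC R n t x * (phin (row_of_tuple x))%:E))%E).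
  (* Since p >= 0, the positive and negative parts of p phi are p [phip] and p [phin], even where p
     is infinite, because 0 times [+oo] is 0. *)
  congr (fine (_ - _)%E); apply: eq_integral => x _.
    rewrite funeposE -/(row_of_tuple x).
    have [y0|y0] := leP 0 (phi (row_of_tuple x)).
      have py : (0 <= @p_BC R n t x * (phi (row_of_tuple x))%:E)%E.
        by rewrite mule_ge0// lee_fin.
      rewrite (max_idPl py); congr (_ * _%:E)%E.
      by rewrite /phip ger0_norm//; lra.
    have py : (@p_BC R n t x * (phi (row_of_tuple x))%:E <= 0)%E.
      by rewrite mule_ge0_le0// lee_fin ltW.
    by rewrite (max_idPr py) /phip ltr0_norm// addNr mul0r mule0.
  rewrite funenegE -/(row_of_tuple x) -muleN -EFinN.
  have [y0|y0] := leP 0 (phi (row_of_tuple x)).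
    have py : (@p_BC R n t x * (- phi (row_of_tuple x))%:E <= 0)%E.
      by rewrite mule_ge0_le0// lee_fin oppr_le0.
    by rewrite (max_idPr py) /phin ger0_norm// subrr mul0r mule0.
  have py : (0 <= @p_BC R n t x * (- phi (row_of_tuple x))%:E)%E.
    by rewrite mule_ge0// lee_fin oppr_ge0 ltW.
  rewrite (max_idPl py); congr (_ * _%:E)%E.
  by rewrite /phin ltr0_norm//; lra.
rewrite (ge0_integral_p_BC_continuous t0 cphip phip0 phipM).
rewrite (ge0_integral_p_BC_continuous t0 cphin phin0 phinM).
rewrite -EFinB /= -mulrBr; congr (_ * _).
have ip := integrable_poisson (continuous_heat cphip phipM) (heat_bounded cphip phipM) t0.
have inn := integrable_poisson (continuous_heat cphin phinM) (heat_bounded cphin phinM) t0.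
rewrite -RintegralB//; apply: eq_Rintegral => s _; rewrite -mulrBl; congr (_ * _).
rewrite /heat /gauss_mean -RintegralB//.
- apply: eq_Rintegral => z _; rewrite /phip /phin; lra.
- exact: (integrable_gauss_mean cphip phipM).
- exact: (integrable_gauss_mean cphin phinM).
Qed.

(** The substitution s = t u moves all dependence on t from the kernel into the argument of [h]. *)
Lemma poisson_integral_scale (h : R -> R) (t : R) : 0 < t -> continuous h ->
  \int[mu]_(s in `[0, +oo[) (h s * poisson t s) =
  \int[mu]_(u in `[0, +oo[) (h (t * u) * kappa u).
Proof.
move=> t0 ch; rewrite Rintegral_mkcond [RHS]Rintegral_mkcond /Rintegral.
congr fine.
pose F := EFin \o ((fun s => h s * poisson t s) \_ `[0, +oo[).
have mF : measurable_fun setT F.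
  apply/measurable_EFinP; rewrite patch_indic; apply: measurable_funM.
    apply: continuous_measurable_fun => s.
    by apply: cvgM; [exact: ch|exact: continuous_poisson].
  exact: measurable_indic.
rewrite [LHS](integral_scale t0 mF); apply: eq_integral => u _.
rewrite /F/= -EFinM; congr EFin; rewrite !patch_indic/= !indicE.
rewrite (_ : (t * u \in `[0, +oo[%classic) = (u \in `[0, +oo[%classic)); last first.
  by apply/idP/idP; rewrite !inE/= !in_itv/= !andbT pmulr_rge0.
rewrite !mulrA; congr (_ * _); rewrite /poisson /oneDsqr; field.
by rewrite !gt_eqF// ltr_pwDl ?sqr_ge0// exprn_gt0.
Qed.

(** After rescaling, the integrand makes sense for every real t and is dominated by M / (1 + u^2),
    so the integral is continuous at t = 0. Its value there is h(0) times the mass pi/2 of 1 / (1 +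
    u^2). *)
Lemma cvg_poisson_mean (h : R -> R) (M : R) : continuous h ->
  (forall s, `|h s| <= M) ->
  2 / pi * \int[mu]_(s in `[0, +oo[) (h s * poisson t s) @[t --> 0^'+] --> h 0.
Proof.
move=> ch hM.
have mI : measurable (`[0%R, +oo[%classic : set (measurableTypeR R)) by [].
pose f (t u : R) := h (t * u) * kappa u.
have ck : continuous kappa by exact: continuous_oneDsqrV.
have k0 s : 0 <= kappa s by rewrite invr_ge0 (le_trans ler01)// oneDsqr_ge1.
have chs (t : R) : continuous (fun u => h (t * u)).
  move=> u; apply: (@continuous_comp _ _ _ (fun u => t * u) h).
    exact: mulrl_continuous.
  exact: ch.
have chl (u : R) : continuous (fun t : R => h (t * u)).
  move=> t; apply: (@continuous_comp _ _ _ (fun t : R => t * u) h).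
    exact: mulrr_continuous.
  exact: ch.
have int_f (t : R) : mu.-integrable `[0, +oo[ (EFin \o f t).
  apply: (@integrable_mul_kernel R _ M (chs t) (fun u => hM (t * u)) kappa 1) => //.
  by move=> s; rewrite mul1r ger0_norm.
have cI : {for 0, continuous (fun t => \int[mu]_(u in `[0, +oo[) f t u)}.
  apply: (@continuity_under_integral R _ _ mu f `[0, +oo[%classic mI (-1) 1 _ _
    (fun u => M * kappa u)).
  - by move=> t _; exact: int_f.
  - apply: aeW => u _ t _; apply: cvgM; last exact: cvg_cst.
    exact: chl.
  - exact: (integrableZl mI M (@integrable_oneDsqrV R)).
  - move=> t _; apply: aeW => u _; rewrite normrM (ger0_norm (k0 u)).
    by rewrite ler_wpM2r.
  - by rewrite inE/= in_itv/=; lra.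
have I0 : 2 / pi * \int[mu]_(u in `[0, +oo[) f 0 u = h 0.
  rewrite /f; under eq_Rintegral do rewrite mul0r.
  rewrite RintegralZl//; last exact: integrable_oneDsqrV.
  rewrite /Rintegral integral0y_oneDsqr/=.
  by move: (@pi R) (pi_gt0 R) => p p0; field; rewrite gt_eqF.
have cI' : 2 / pi * \int[mu]_(u in `[0, +oo[) f t u @[t --> 0^'+] -->
    2 / pi * \int[mu]_(u in `[0, +oo[) f 0 u.
  by apply: cvg_at_right_filter; apply: cvgM; [exact: cvg_cst|exact: cI].
rewrite I0 in cI'; apply: cvg_trans cI'.
apply: near_eq_cvg; near=> t.
by congr (_ * _); rewrite -poisson_integral_scale//; near: t; exact: nbhs_right_gt.
Unshelve. all: by end_near. Qed.

End regular_distribution.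

Section equation.
Context {R : realType} (n : nat).
Implicit Types phi : 'rV[R]_n -> R.
Local Notation mu := (@lebesgue_measure R).
Local Notation mean phi t :=
  (2 / pi * \int[mu]_(s in `[0, +oo[) (heat phi s * poisson t s)).

Lemma BC_initial_p_BC : BC_initial (@p_BC R n).
Proof.
move=> phi tphi; have cphi := test_function_continuous tphi.
have [M _ phiM] := test_function_bounded tphi.
rewrite tensor_dirac -heat0.
apply: cvg_trans; last first.
  exact: cvg_poisson_mean (continuous_heat cphi phiM) (heat_bounded cphi phiM).
apply: near_eq_cvg; near=> t.
by rewrite (regular_distr_p_BC _ cphi phiM)//; near: t; exact: nbhs_right_gt.
Unshelve. all: by end_near. Qed.

Let lap phi (s : R) := \sum_j heat (partial j (partial j phi)) s.

Let lap_bounded phi : test_function phi -> exists M : R, forall s : R, `|lap phi s| <= M.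
Proof.
move=> tphi.
have tpp j := test_function_partial j (test_function_partial j tphi).
have bpp j := test_function_bounded (tpp j).
exists (\sum_j s2val (cid2 (bpp j))) => s.
apply: le_trans (ler_norm_sum _ _ _) _; apply: ler_sum => j _.
apply: heat_bounded; first exact: test_function_continuous.
exact: (s2valP' (cid2 (bpp j))).
Qed.

Let continuous_lap phi : test_function phi -> continuous (lap phi).
Proof.
move=> tphi.
have tpp j := test_function_partial j (test_function_partial j tphi).
apply: continuous_bigsum => j.
have [M _ M_] := test_function_bounded (tpp j).
exact: (continuous_heat (test_function_continuous (tpp j)) M_).
Qed.

Let is_derive_lap phi (s : R) : test_function phi -> 0 < s ->
  is_derive s 1 (lap phi)
    (\sum_j 2^-1 * lap (partial j (partial j phi)) s).
Proof.
move=> tphi s0.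
have tpp j := test_function_partial j (test_function_partial j tphi).
have -> : lap phi = \sum_j heat (partial j (partial j phi)).
  by apply/funext => s'; rewrite fct_sumE.
by apply: is_derive_sum => j; exact: is_derive_heat.
Qed.

(** Each use of the heat equation contributes a factor 1/2: two of them give the coefficient 1/2^2
    of the bilaplacian, while one, against the prefactor 2/pi, gives the 1 / (pi t) of the boundary
    term. *)
Lemma second_derivative_mean phi (t : R) : test_function phi -> 0 < t ->
  2 / pi * \int[mu]_(s in `[0, +oo[) (heat phi s * poisson_tt t s) =
  - (1 / 2 ^+ 2) *
    (\sum_i \sum_j mean (partial j (partial j (partial i (partial i phi)))) t)
  - 1 / (pi * t) * \sum_j partial j (partial j phi) 0.
Proof.
move=> tphi t0.
have tpp j := test_function_partial j (test_function_partial j tphi).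
have tpppp i j := test_function_partial j (test_function_partial j (tpp i)).
have [M0 M0_gt0 M0_] := test_function_bounded tphi.
have [M1 M1_] := lap_bounded tphi.
pose h1 s := 2^-1 * lap phi s.
pose h2 s := 2^-1 * \sum_i 2^-1 * lap (partial i (partial i phi)) s.
have ch0 := continuous_heat (test_function_continuous tphi) M0_.
have hM0 := heat_bounded (test_function_continuous tphi) M0_.
have M1_ge0 : 0 <= M1 by rewrite (le_trans _ (M1_ 0)).
have ch1 : continuous h1.
  by move=> s; apply: cvgM; [exact: cvg_cst|exact: continuous_lap].
have bM2 i := lap_bounded (tpp i).
pose M2 i : R := sval (cid (bM2 i)).
have M2_ i s : `|lap (partial i (partial i phi)) s| <= M2 i.
  exact: (svalP (cid (bM2 i))).
have M2_ge0 i : 0 <= M2 i by rewrite (le_trans _ (M2_ i 0)).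
have ch2 : continuous h2.
  move=> s; apply: cvgM; first exact: cvg_cst.
  apply: (@continuous_bigsum _ _ _ (fun i s => 2^-1 * lap (partial i (partial i phi)) s)).
  by move=> i u; apply: cvgM; [exact: cvg_cst|exact: continuous_lap].
have M2s_ge0 : 0 <= \sum_i M2 i by apply: sumr_ge0.
(* The integration by parts asks for one bound common to [heat phi], [h1] and [h2]. *)
pose M := M0 + M1 + \sum_i M2 i.
have half_le (a b : R) : 0 <= b -> `|a| <= b -> `|2^-1 * a| <= b.
  by move=> b0 ab; rewrite normrM gtr0_norm ?invr_gt0//; lra.
have b0 s : `|heat phi s| <= M by apply: (le_trans (hM0 s)); rewrite /M; lra.
have b1 s : `|h1 s| <= M.
  by apply: (@le_trans _ _ M1); [exact: half_le|rewrite /M; lra].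
have b2 s : `|h2 s| <= M.
  apply: (@le_trans _ _ (\sum_i M2 i)); last by rewrite /M; lra.
  apply: (half_le _ _) => //; apply: (le_trans (ler_norm_sum _ _ _)).
  apply: ler_sum => i _; exact: (half_le _ _ (M2_ge0 i) (M2_ i s)).
have d0 (s : R) : 0 < s -> is_derive s 1 (heat phi) (h1 s).
  by move=> s0; exact: is_derive_heat.
have d1 (s : R) : 0 < s -> is_derive s 1 h1 (h2 s).
  by move=> s0; exact: (is_deriveZ 2^-1 (is_derive_lap tphi s0)).
rewrite (poisson_integration_by_parts t0 ch0 ch1 ch2 b0 b1 b2 d0 d1).
have ip i j : mu.-integrable `[0, +oo[ (EFin \o (fun s =>
    heat (partial j (partial j (partial i (partial i phi)))) s * poisson t s)).
  have [K _ K_] := test_function_bounded (tpppp i j).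
  have cK := test_function_continuous (tpppp i j).
  exact: (integrable_poisson (continuous_heat cK K_) (heat_bounded cK K_) t0).
have mI : measurable (`[0%R, +oo[%classic : set (measurableTypeR R)) by [].
have ip2 i : mu.-integrable `[0, +oo[ (EFin \o (fun s => \sum_j
    heat (partial j (partial j (partial i (partial i phi)))) s * poisson t s)).
  rewrite (_ : _ \o _ = (fun s => \sum_j (EFin \o (fun s =>
    heat (partial j (partial j (partial i (partial i phi)))) s * poisson t s)%R) s)%E).
    exact: integrable_sum.
  by apply/funext => s; rewrite /= sumEFin.
have ip3 : mu.-integrable `[0, +oo[ (EFin \o (fun s => \sum_i \sum_j
    heat (partial j (partial j (partial i (partial i phi)))) s * poisson t s)).
  rewrite (_ : _ \o _ = (fun s => \sum_i (EFin \o (fun s => \sum_j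
    heat (partial j (partial j (partial i (partial i phi)))) s * poisson t s)%R) s)%E).
    exact: integrable_sum.
  by apply/funext => s; rewrite /= sumEFin.
have -> : \int[mu]_(s in `[0, +oo[) (h2 s * poisson t s) = 1 / 2 ^+ 2 *
    \sum_i \sum_j \int[mu]_(s in `[0, +oo[)
      (heat (partial j (partial j (partial i (partial i phi)))) s * poisson t s).
  under [in RHS]eq_bigr do rewrite -Rintegral_sum//.
  rewrite -Rintegral_sum// -RintegralZl//; apply: eq_Rintegral => s _.
  transitivity (1 / 2 ^+ 2 *
      ((\sum_i lap (partial i (partial i phi)) s) * poisson t s)).
    by rewrite /h2 -mulr_sumr; field.
  congr (_ * _); rewrite mulr_suml; apply: eq_bigr => i _.
  by rewrite /lap mulr_suml.
(* At s = 0 the heat semigroup is evaluation at the origin, which is how the Dirac terms arise. *)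
have -> : h1 0 = 2^-1 * \sum_j partial j (partial j phi) 0.
  by rewrite /h1 /lap; congr (_ * _); apply: eq_bigr => j _; rewrite heat0.
under [X in _ = - (1 / 2 ^+ 2) * X - _]eq_bigr do rewrite -mulr_sumr.
rewrite -mulr_sumr; move: (@pi R) (pi_gt0 R) => p p0.
by field; rewrite !gt_eqF.
Qed.

Lemma BC_equation_p_BC : BC_equation (@p_BC R n).
Proof.
move=> phi tphi t t0 F.
have cphi := test_function_continuous tphi.
have [M _ phiM] := test_function_bounded tphi.
have ch := continuous_heat cphi phiM.
have hM := heat_bounded cphi phiM.
pose F1 r := 2 / pi * \int[mu]_(s in `[0, +oo[) (heat phi s * poisson_t r s).
pose F2 r := 2 / pi * \int[mu]_(s in `[0, +oo[) (heat phi s * poisson_tt r s).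
have near_pos (r : R) : 0 < r -> \forall r' \near r, 0 < r'.
  by move=> r0; exact: lt_nbhsr.
have dF (r : R) : 0 < r -> is_derive r 1 F (F1 r).
  (* [F] is identified with the mean for positive times only, so derivatives are compared through
     equality near [r]. *)
  move=> r0; apply: (@near_eq_is_derive _ _ _ (fun r => mean phi r)).
    near=> r'; rewrite /F (regular_distr_p_BC _ cphi phiM)//.
    by near: r'; exact: near_pos.
  exact: (is_deriveZ (2 / pi) (is_derive_poisson_integral ch hM r0)).
have F'E (r : R) : 0 < r -> F^`()%classic r = F1 r.
  by move=> r0; rewrite derive1E; have := dF r r0 => ?; exact: derive_val.
have dF1 : is_derive t 1 F^`()%classic (F2 t).
  apply: (@near_eq_is_derive _ _ _ F1).
    by near=> r; rewrite F'E//; near: r; exact: near_pos.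
  exact: (is_deriveZ (2 / pi) (is_derive_poisson_t_integral ch hM t0)).
split.
- by have := dF t t0 => ?; exact: ex_derive.
- exact: ex_derive.
rewrite [LHS]derive1E derive_val /F2 second_derivative_mean//.
congr (_ * _ - _ * _).
  (* The signs of the four transposed derivatives cancel in pairs, and the outer Laplacian, in [i],
     reaches [phi] first. *)
  rewrite /laplacian_distr /ddistr; apply: eq_bigr => i _; rewrite opprK.
  apply: eq_bigr => j _; rewrite opprK.
  have tpppp := test_function_partial j (test_function_partial j
    (test_function_partial i (test_function_partial i tphi))).
  have [K _ K_] := test_function_bounded tpppp.
  by rewrite (regular_distr_p_BC _ (test_function_continuous tpppp) K_).
by apply: eq_bigr => j _; rewrite dirac_secondE.
Unshelve. all: by end_near. Qed.

End equation.

Theorem theorem3p2 (R : realType) (d : nat) (hd : (0 < d)%N)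
    (disp : measure_display) (Omega : measurableType disp)
    (P : probability Omega R)
    (B : 'I_d -> R -> {RV P >-> R}) (C : R -> {RV P >-> R})
    (hB : forall j, standard_brownian (B j)) (hC : standard_cauchy C)
    (hBC : independent_processes B C) :
  [/\ (forall t : R, 0 < t -> joint_density P (J_BC B C t) (@p_BC R d t)),
      BC_equation (@p_BC R d) &
      BC_initial (@p_BC R d)].
Proof.
split; [|exact: BC_equation_p_BC|exact: BC_initial_p_BC].
by move=> t t0; exact: joint_density_J_BC.
Qed.
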